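(* Let $d\geq 1$ and let $q=(q_1,\dots,q_d)$ be a vector of positive integers, and let $Q=\prod_{i=1}^d(q_i+1)-1$. Let $\mathcal{MA}_q\subseteq\mathbb{P}^N$ be the autocovariance variety of order $q$. Then $$\dim(\mathcal{MA}_q)=Q=\prod_{i=1}^d(q_i+1)-1,$$ and if $d>1$, then $$\deg(\mathcal{MA}_q)=2^{Q-1}=2^{\prod_{i=1}^d(q_i+1)-2}.$$
   Context: Work over $\mathbb{C}$. For $u,v\in\mathbb{Z}^d$ write $[u,v]=\{s\in\mathbb{Z}^d: u_i\le s_i\le v_i,\ 1\le i\le d\}$, and let $\succeq$ be the lexicographic order on $\mathbb{Z}^d$. Put $Q=\prod_{i=1}^d(q_i+1)-1$ and $N=\bigl(\prod_{i=1}^d(2q_i+1)-1\bigr)/2$. For $a=(a_k)_{k\in[0,q]}\in\mathbb{C}^{Q+1}$ and $t\in[-q,q]$ let $$\gamma(t)=\gamma_a(t)=\sum_{k,\,k+t\in[0,q]}a_k a_{k+t}.$$ Since $\gamma(-t)=\gamma(t)$, only the $N+1$ indices $t\in[-q,q]$ with $t\succeq 0$ are kept. The autocovariance map is $\Gamma_q:\mathbb{P}^Q\dashrightarrow\mathbb{P}^N$, $a\mapsto(\gamma_a(t))_{t\in[-q,q],\,t\succeq0}$, and the autocovariance variety $\mathcal{MA}_q\subseteq\mathbb{P}^N$ is the image of $\Gamma_q$. Dimension and degree are those of a projective variety in $\mathbb{P}^N$. *)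

(* Defs.v *)
From HB Require Import structures.
From mathcomp Require Import all_boot all_order all_algebra.
From mathcomp Require Import boolp classical_sets reals complex mpoly zify.

Set Implicit Arguments.
Unset Strict Implicit.
Unset Printing Implicit Defensive.

Import Order.TTheory GRing.Theory Num.Theory.

Local Open Scope classical_set_scope.
Local Open Scope ring_scope.

(* A point of P^n over K is a line through the origin of K^(n+1). *)
Record proj (K : fieldType) (n : nat) := Proj {
  line :> {vspace 'rV[K]_n.+1};
  _ : \dim line == 1%N
}.

(* For homogeneous f this does not depend on the chosen nonzero v in x. *)
Definition vanishes_at (K : fieldType) (n : nat) (f : {mpoly K[n.+1]})
    (x : proj K n) : Prop :=
  forall v : 'rV[K]_n.+1, v \in line x -> f.@[fun i => v 0 i] = 0.

Definition zariski_closed (K : fieldType) (n : nat) (A : set (proj K n)) :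
    Prop :=
  exists2 S : set {mpoly K[n.+1]},
    (forall f, S f -> exists e : nat, f \is e.-homog) &
    A = [set x | forall f, S f -> vanishes_at f x].

(* Z is closed in the topology that X inherits from P^n. *)
Definition closed_in (K : fieldType) (n : nat) (X Z : set (proj K n)) : Prop :=
  exists2 A, zariski_closed A & Z = A `&` X.

Definition irreducible (K : fieldType) (n : nat) (Z : set (proj K n)) : Prop :=
  Z !=set0 /\
  forall Z1 Z2, closed_in Z Z1 -> closed_in Z Z2 -> Z = Z1 `|` Z2 ->
    Z1 = Z \/ Z2 = Z.

Definition irreducible_chain (K : fieldType) (n : nat) (X : set (proj K n))
    (r : nat) (Z : nat -> set (proj K n)) : Prop :=
  (forall i, (i <= r)%N -> closed_in X (Z i) /\ irreducible (Z i)) /\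
  (forall i, (i < r)%N -> Z i `<` Z i.+1).

(* Dimension of X as a topological space: the largest r for which there is a
   chain Z_0 < Z_1 < ... < Z_r of irreducible closed subsets of X. *)
Definition has_dim (K : fieldType) (n : nat) (X : set (proj K n)) (r : nat) :
    Prop :=
  (exists Z, irreducible_chain X r Z) /\
  (forall s Z, irreducible_chain X s Z -> (s <= r)%N).

(* P is the Hilbert polynomial of the homogeneous coordinate ring S / I(X):
   P(m) = dim (S_m / I(X)_m) for m >> 0, where I below is I(X)_m. *)
Definition hilbert_poly (K : fieldType) (n : nat) (X : set (proj K n))
    (P : {poly rat}) : Prop :=
  exists m0 : nat, forall m : nat, (m0 <= m)%N ->
    exists2 I : {vspace dhomog n.+1 K m},
      (forall f : dhomog n.+1 K m,
         f \in I <-> (forall x, X x -> vanishes_at (mpoly_of_dhomog f) x)) &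
      P.[m%:R] = (\dim (fullv : {vspace dhomog n.+1 K m}) - \dim I)%:R.

(* deg X = r! times the leading coefficient of the Hilbert polynomial, whose
   degree r is dim X. *)
Definition has_degree (K : fieldType) (n : nat) (X : set (proj K n))
    (e : nat) : Prop :=
  exists2 P : {poly rat}, hilbert_poly X P &
    e%:R = ((size P).-1)`!%:R * lead_coef P.

(* The set [0, q]. *)
Definition box (d : nat) (q : 'I_d -> nat) : finType :=
  {dffun forall i : 'I_d, 'I_(q i).+1}.

(* The set [-q, q]: t represents the vector with coordinates t i - q i. *)
Definition lag (d : nat) (q : 'I_d -> nat) : finType :=
  {dffun forall i : 'I_d, 'I_(2 * q i).+1}.

Definition lagz (d : nat) (q : 'I_d -> nat) (t : lag q) (i : 'I_d) : int :=
  (t i)%:Z - (q i)%:Z.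

Definition lag_lexi (d : nat) (q : 'I_d -> nat) (t : lag q) :
    d.-tuplelexi int := [tuple lagz t i | i < d].

Definition nonneg_lags (d : nat) (q : 'I_d -> nat) : {set lag q} :=
  [set t : lag q | ([tuple 0 | i < d] : d.-tuplelexi int) <= lag_lexi t]%O%SET.

Definition ambient_dim (d : nat) (q : 'I_d -> nat) : nat :=
  ((\prod_(i < d) (2 * q i + 1) - 1) %/ 2)%N.

(* Sum over k in [0, q] with l = k + t in [0, q]. *)
Definition autocov (K : fieldType) (d : nat) (q : 'I_d -> nat)
    (a : {ffun box q -> K}) (t : lag q) : K :=
  \sum_(k : box q)
    \sum_(l : box q | [forall i, (l i)%:Z == (k i)%:Z + lagz t i]) a k * a l.

Lemma zero_lag_subproof (d : nat) (q : 'I_d -> nat) (i : 'I_d) :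
  (q i < (2 * q i).+1)%N.
Proof. by lia. Qed.

Section CardNonnegLags.
Variables (d : nat) (q : 'I_d -> nat).

Let opp_lag (t : lag q) : lag q := [ffun i => rev_ord (t i)].

Let opp_lagK : involutive opp_lag.
Proof. by move=> t; apply/ffunP => i; rewrite !ffunE rev_ordK. Qed.


Let lagz_opp t i : lagz (opp_lag t) i = - lagz t i.
Proof.
rewrite /lagz ffunE /=; have := ltn_ord (t i).
move: (nat_of_ord _) => a; lia.
Qed.

Let zero_lexi : d.-tuplelexi int := [tuple 0 | i < d].

Let le0_opp t : (zero_lexi <= lag_lexi (opp_lag t))%O = (lag_lexi t <= zero_lexi)%O.
Proof.
have H (I : Type) (f : I -> int) (s : seq I) :
    (([seq 0 | _ <- s] : seqlexi int) <= [seq - f x | x <- s] :> seqlexi int)%O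
    = (([seq f x | x <- s] : seqlexi int) <= [seq 0 | _ <- s] :> seqlexi int)%O.
  elim: s => [|x s IH] //=; rewrite !lexi_cons IH.
  by rewrite oppr_ge0 oppr_le0.
have -> : lag_lexi (opp_lag t) = [tuple - lagz t i | i < d] :> d.-tuplelexi int.
  by apply: eq_mktuple => i; rewrite lagz_opp.
exact: (H _ (lagz t) (ord_tuple d)).
Qed.

Let card_lag : #|lag q| = (\prod_(i < d) (2 * q i + 1))%N.
Proof.
rewrite card_dep_ffun -[foldr _ _ _]/(foldr muln 1%N _) foldrE big_map big_enum /=.
by apply: eq_bigr => i _; rewrite card_ord addn1.
Qed.

Lemma card_nonneg_lags : #|nonneg_lags q| = (ambient_dim q).+1.
Proof.
set A := nonneg_lags q; set B := opp_lag @: A.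
have cB : #|B| = #|A| by apply/card_imset/inv_inj.
have memB t : (t \in B) = (lag_lexi t <= zero_lexi)%O.
  rewrite -[t]opp_lagK mem_imset; last exact/inv_inj.
  by rewrite inE opp_lagK le0_opp.
have AB : (A :|: B = [set: lag q])%SET.
  by apply/setP => t; rewrite finset.in_setU memB !inE le_total.
pose z : lag q := [ffun i => @Ordinal (2 * q i).+1 (q i) (zero_lag_subproof q i)].
have AIB : (A :&: B = [set z])%SET.
  apply/setP => t; rewrite finset.in_setI memB !inE -eq_le.
  apply/eqP/eqP => [e|->].
    apply/ffunP => i; rewrite ffunE; apply: val_inj => /=.
    have := congr1 (fun u : d.-tuple int => tnth u i) e.
    rewrite /zero_lexi /lag_lexi !tnth_mktuple /lagz.
    by move: (nat_of_ord (t i)) => k; lia.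
  by apply: eq_mktuple => i; rewrite /lagz ffunE /=; lia.
have := cardsUI A B; rewrite AB AIB cB cards1 cardsT card_lag /ambient_dim.
move: (\prod_(i < d) _)%N #|A| => a b; lia.
Qed.

End CardNonnegLags.

Definition nth_lag (d : nat) (q : 'I_d -> nat) (j : 'I_(ambient_dim q).+1) :
    lag q :=
  enum_val (cast_ord (esym (card_nonneg_lags q)) j).

Definition autocov_vec (K : fieldType) (d : nat) (q : 'I_d -> nat)
    (a : {ffun box q -> K}) : 'rV[K]_(ambient_dim q).+1 :=
  \row_j autocov a (nth_lag j).

(* The image of [a] |-> [autocov_vec a]: a vector a at which the map is
   undefined (autocov_vec a = 0) contributes nothing, since line y has
   dimension 1. *)
Definition autocov_variety (K : fieldType) (d : nat) (q : 'I_d -> nat) :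
    set (proj K (ambient_dim q)) :=
  [set y | exists2 a : {ffun box q -> K},
     a != 0 & line y = <[autocov_vec a]>%VS].

(* Main.v *)
From HB Require Import structures.
From mathcomp Require Import all_boot all_order all_algebra.
From mathcomp Require Import boolp classical_sets reals complex mpoly zify ring lra.
Require Import Defs.

(** Let [A] be the Laurent polynomial with coefficients [a]; the autocovariances of [a] are the
    coefficients of [A(x) A(1/x)]. They are quadrics in [a] without common zeros.

    Dimension. Order the box by mixed radix weight. The closures of the images of the coordinate
    subspaces spanned by the first points of the box form a chain of irreducible sets, strict
    because each new point contributes a lag that did not occur before ([stratum_lt]). In the
    other direction, every step of a chain of irreducible closed sets adds one degree to the
    growth of the Hilbert function ([hilbert_chain]), whereas pulling back to the source bounds
    the growth by the number of variables ([chain_length_le]).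

    Degree. Geometrically, a map given by quadrics without common zeros has degree [2^Q] in total,
    and a generic fibre consists of the two points [a] and its reversal, since [A] is irreducible
    when there are at least two variables. The proof is an algebraic version of this. Let [B] be
    the algebra generated by the autocovariances inside the polynomial ring in the [a_k]. The
    elements of [B] are even and invariant under reversal, and the even invariants of degree [2 m]
    make up half of all forms of that degree up to lower order terms. What is needed is a nonzero
    [g] in [B] that multiplies all even invariants into [B] ([autocor_conductor]); then both have
    the same asymptotic growth, [2^(Q-1) m^Q / Q!] ([degree_quadric_involution]).

    Such a [g] comes from one well-chosen fibre. The polynomial ring is a finite module over [B],
    because a power of each [a_k] lies in the ideal of the autocovariances ([autocor_radical],
    [finite_over_autocor]). If the fibre through a point [P] is unramified and consists only of
    [P], its reversal and their negatives, then the Nullstellensatz and Cramer's rule, used as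
    Nakayama's lemma, show that the even invariants and [B] coincide near [P]. The point [P] has
    only three nonzero entries, in such a way that its generating polynomial becomes
    [x + y^n (1 + x^p)] once all variables but the first are replaced by powers of one variable
    [y]. For this trinomial the factorizations [B * B_rev = A * A_rev] and the tangent equation
    [A * b_rev + b * A_rev = 0] can be solved by comparing coefficients ([trinomial_prime],
    [special_fibre], [special_unramified]).

    That the Hilbert function is a polynomial in large degrees is proved by passing to the initial
    ideal and counting the exponents outside an upward closed set, which is controlled by
    Dickson's lemma ([hilbert_function_poly]). *)

Set Implicit Arguments.
Unset Strict Implicit.
Unset Printing Implicit Defensive.

Import Order.TTheory GRing.Theory Num.Theory.

Local Open Scope ring_scope.

(** * Functions that are eventually polynomial *)

Definition eventually_poly (f : nat -> nat) :=
  exists P : {poly rat}, exists m0, forall m, (m0 <= m)%N -> P.[m%:R] = (f m)%:R.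

(** By induction on the degree: the difference operator sends [X^(n+1)] to [(n+1) X^n]
    plus lower terms, which cancels the leading term of [p]. *)
Lemma poly_antidifference (p : {poly rat}) :
  exists P : {poly rat}, forall x, P.[x + 1] - P.[x] = p.[x].
Proof.
elim: {p}_.+1 {-2}p (ltnSn (size p)) => // s IH p; rewrite ltnS => szp.
case: (posnP (size p)) => [/eqP|p0].
  by rewrite size_poly_eq0 => /eqP->; exists 0 => x; rewrite !horner0 subr0.
pose n := (size p).-1.
have szpn : size p = n.+1 by rewrite /n prednK.
pose T : {poly rat} := ('X + 1) ^+ n.+1 - 'X^(n.+1).
have TE : T = \sum_(i < n.+1) ('X^i *+ 'C(n.+1, i)).
  rewrite /T addrC (addrC 'X) exprDn big_ord_recr /= binn subnn expr0 mul1r addrC addrK.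
  by apply: eq_bigr => i _; rewrite expr1n mul1r.
have coefT k : T`_k = if (k <= n)%N then 'C(n.+1, k)%:R else 0.
  rewrite TE coef_sum; case: leqP => kn.
    rewrite (bigD1 (Ordinal (kn : (k < n.+1)%N))) //= coefMn coefXn eqxx big1 ?addr0 //.
    move=> i /eqP ik; rewrite coefMn coefXn; case: eqP => [ki|_]; last by rewrite mul0rn.
    by case: ik; apply: val_inj.
  rewrite big1 // => i _; rewrite coefMn coefXn; case: eqP => [ki|_]; last by rewrite mul0rn.
  by have := ltn_ord i; rewrite -ki ltnS leqNgt kn.
pose c := lead_coef p / n.+1%:R.
have szr : (size (p - c *: T)%R < s)%N.
  apply: leq_trans szp; rewrite szpn ltnS; apply/leq_sizeP => k nk.
  rewrite coefB coefZ coefT; case: leqP => kn; last first.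
    by rewrite mulr0 subr0 nth_default // szpn.
  have -> : k = n by apply/eqP; rewrite eqn_leq kn nk.
  by rewrite /c lead_coefE binSn mulfVK ?subrr // pnatr_eq0.
have [P0 P0E] := IH _ szr.
exists (P0 + c *: 'X^(n.+1)) => x; move: (P0E x).
rewrite /T !hornerE => h.
by move: h; move: (P0.[x + 1]) (P0.[x]) (p.[x]) ((x + 1) ^+ _) (x ^+ _) => a b e u v h; lra.
Qed.

Lemma eventually_poly_shift f k : eventually_poly f ->
  eventually_poly (fun m => if (k <= m)%N then f (m - k)%N else 0%N).
Proof.
case=> P [m0 PE]; exists (P \Po ('X - k%:R%:P)), (m0 + k)%N => m mk.
have km : (k <= m)%N by lia.
by rewrite km -PE ?horner_comp ?hornerE ?natrB //; lia.
Qed.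

Lemma eventually_poly_add f g : eventually_poly f -> eventually_poly g ->
  eventually_poly (fun m => (f m + g m)%N).
Proof.
case=> P [m0 PE] [P' [m0' PE']]; exists (P + P'), (maxn m0 m0') => m.
by rewrite geq_max => /andP[h h']; rewrite hornerE PE // PE' // natrD.
Qed.

Lemma eventually_poly_eq f g m0 : (forall m, (m0 <= m)%N -> f m = g m) ->
  eventually_poly f -> eventually_poly g.
Proof.
move=> fg [P [m1 PE]]; exists P, (maxn m0 m1) => m.
by rewrite geq_max => /andP[h h']; rewrite PE // fg.
Qed.

Lemma eventually_poly_sum (I : Type) (r : seq I) (F : I -> nat -> nat) :
  (forall i, eventually_poly (F i)) ->
  eventually_poly (fun m => \sum_(i <- r) F i m)%N.
Proof.
move=> FP; elim: r => [|i r IH].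
  by exists 0, 0%N => m _; rewrite big_nil horner0.
apply: (@eventually_poly_eq (fun m => F i m + \sum_(j <- r) F j m)%N _ 0).
  by move=> m _; rewrite big_cons.
exact: eventually_poly_add.
Qed.

(** From [m0] on, the partial sums and an antidifference have the same increments. *)
Lemma eventually_poly_psum f : eventually_poly f ->
  eventually_poly (fun m => \sum_(i < m.+1) f i)%N.
Proof.
case=> P [m0 PE]; have [S SE] := poly_antidifference P.
pose c : rat := (\sum_(i < m0) f i)%N%:R - S.[m0%:R].
exists ((S \Po ('X + 1)) + c%:P), m0 => m.
have key k : (m0 <= k)%N -> (\sum_(i < k) f i)%N%:R = S.[k%:R] + c.
  elim: k => [|k IH]; first by rewrite leqn0 /c => /eqP ->; rewrite addrC subrK.
  rewrite leq_eqVlt => /orP[/eqP<-|]; first by rewrite /c addrC subrK.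
  rewrite ltnS => mk; rewrite big_ord_recr natrD IH // -PE // -SE.
  rewrite -[k.+1%:R]natr1 /=; lra.
by move=> mm; rewrite key ?leqW // hornerD horner_comp !hornerE natr1.
Qed.

(** * Dickson's lemma and exponents outside an upward closed set *)

Definition seq_le (s t : seq nat) := all2 leq s t.

(** From each index move to a later one at which [u] is minimal among all later values; the
    values met on the way never decrease. *)
Lemma mono_subseq (u : nat -> nat) : exists phi : nat -> nat,
  (forall i, (phi i < phi i.+1)%N) /\ (forall i, (u (phi i) <= u (phi i.+1))%N).
Proof.
have nextP k : exists j, (k < j)%N /\ forall l, (k < l)%N -> (u j <= u l)%N.
  pose P v := `[< exists2 j, (k < j)%N & u j = v >].
  have ex : exists v, P v by exists (u k.+1); apply/asboolP; exists k.+1.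
  case: (ex_minnP ex) => v /asboolP[j kj <-] vmin.
  exists j; split=> // l kl; apply: vmin; apply/asboolP; by exists l.
have [nx nxP] := boolp.choice nextP.
exists (fun i => iter i nx (nx 0)); split=> i /=; case: (nxP (iter i nx (nx 0))) => // lt _.
elim: i lt => [|i IH] /= lt; first by case: (nxP 0) => ? ; apply; apply: leq_ltn_trans lt.
case: (nxP (iter i nx (nx 0))) => h; apply; exact: ltn_trans lt.
Qed.

(** Dickson's lemma: extract a subsequence along which the first entries do not decrease, then
    from it one along which the remaining entries do not decrease. *)
Lemma dickson_subseq n (u : nat -> seq nat) : (forall i, size (u i) = n) ->
  exists phi : nat -> nat,
  (forall i, (phi i < phi i.+1)%N) /\ (forall i, seq_le (u (phi i)) (u (phi i.+1))).
Proof.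
elim: n u => [|n IH] u su.
  exists id; split=> // i; by rewrite (size0nil (su i)) (size0nil (su i.+1)).
have [phi [phi1 phi2]] := mono_subseq (fun i => head 0 (u i)).
have su' i : size (behead (u (phi i))) = n by rewrite size_behead su.
have [psi [psi1 psi2]] := IH _ su'.
have phimono : {homo phi : i j / (i < j)%N} by apply: homo_ltn => //; exact: ltn_trans.
have uphi : {homo (fun i => head 0 (u (phi i))) : i j / (i <= j)%N}.
  by apply: homo_leq => //; exact: leq_trans.
exists (phi \o psi); split=> i /=; first exact: phimono.
have := psi2 i; have := uphi _ _ (ltnW (psi1 i)).
by have := su (phi (psi i)); have := su (phi (psi i.+1)); case: (u _) => // a s; case: (u _) => //= b t _ _ -> ->.
Qed.

Definition upward_closed n (U : pred (seq nat)) :=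
  forall s t, size s = n -> seq_le s t -> U s -> U t.

(** If the chain kept growing, new elements [x_0, x_1, ...] would enter at later and later
    stages; some [x_i] lies below a later [x_j], which was therefore already present. *)
Lemma upward_closed_acc n (U : nat -> pred (seq nat)) : (forall j, upward_closed n (U j)) ->
  (forall j s, size s = n -> U j s -> U j.+1 s) ->
  exists J, forall j s, (J <= j)%N -> size s = n -> U j s = U J s.
Proof.
move=> Uup Uinc; apply: contrapT => nst.
have Umono i j s : (i <= j)%N -> size s = n -> U i s -> U j s.
  move=> ij ss; elim: j ij => [|j IH]; first by rewrite leqn0 => /eqP->.
  by rewrite leq_eqVlt => /orP[/eqP<-//|/IH h /h]; apply: Uinc.
have ex J : exists p : nat * seq nat, [/\ (J < p.1)%N, size p.2 = n, U p.1 p.2 & ~~ U J p.2].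
  apply: contrapT => h; apply: nst; exists J => j s Jj ss.
  apply/idP/idP => [Ujs|]; last exact: Umono.
  apply: contrapT => /negP nU; apply: h; exists (j, s); split=> //=.
  rewrite ltn_neqAle Jj andbT; apply: contraNneq nU => ->; exact: Ujs.
have [w wP] := boolp.choice ex.
pose J i := iter i (fun J => (w J).1) 0%N.
have Jmono : {homo J : i j / (i <= j)%N}.
  by apply: homo_leq => //; [exact: leq_trans|move=> i /=; case: (wP (J i)) => /ltnW].
have [phi [phi1 phi2]] := @dickson_subseq n (fun i => (w (J i)).2) (fun i => let: And4 _ h _ _ := wP (J i) in h).
have [_ s0 U0 _] := wP (J (phi 0)); have [_ s1 _ /negP] := wP (J (phi 1)); apply.
apply: (Uup _ _ _ s0 (phi2 0)); apply: Umono s0 U0.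
exact: (Jmono (phi 0).+1 (phi 1) (phi1 0)).
Qed.

Fixpoint compositions n m : seq (seq nat) :=
  if n is n'.+1 then
    flatten [seq [seq j :: s | s <- compositions n' (m - j)%N] | j <- iota 0 m.+1]
  else if m is 0 then [:: [::]] else [::].

Lemma compositionsS n m :
  compositions n.+1 m = flatten [seq [seq j :: s | s <- compositions n (m - j)] | j <- iota 0 m.+1].
Proof. by []. Qed.

Lemma mem_compositions n m s : (s \in compositions n m) = (size s == n) && (sumn s == m).
Proof.
elim: n m s => [|n IH] m s; first by case: m => [|m]; case: s.
rewrite compositionsS; apply/flatten_mapP/idP => [[j]|].
  rewrite mem_iota add0n ltnS => /andP[_ jm] /mapP[t]; rewrite IH => /andP[/eqP st /eqP mt] ->/=.
  by rewrite st mt eqxx subnKC ?eqxx // -ltnS.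
case: s => [|j s] //=; rewrite eqSS => /andP[ss /eqP sm].
exists j; first by rewrite -[_ :: _]/(iota 0 m.+1) mem_iota ltnS -sm leq_addr.
by apply: map_f; rewrite IH ss -sm addKn eqxx.
Qed.

Lemma compositions_uniq n m : uniq (compositions n m).
Proof.
elim: n m => [|n IH] m; first by case: m.
rewrite compositionsS; apply: allpairs_uniq_dep; first exact: iota_uniq.
  by move=> j _; apply: IH.
by move=> [j s] [k t] _ _ /= [-> ->].
Qed.

(** Slice [U] by the first entry. The slices increase, hence are constant from some [J] on, so
    the count is a finite sum of shifted counts for one entry less plus the partial sums of the
    count for the stable slice. *)
Lemma count_outside_upward_closed n (U : pred (seq nat)) : upward_closed n U ->
  eventually_poly (fun m => count (predC U) (compositions n m)).
Proof.
elim: n U => [|n IH] U Uup.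
  by exists 0, 1%N => -[|m] //= _; rewrite horner0.
pose V j : pred (seq nat) := fun s => U (j :: s).
have Vup j : upward_closed n (V j).
  by move=> s t ss st; apply: (Uup); rewrite /= ?ss // /seq_le /= leqnn.
have [J VJ] : exists J, forall j s, (J <= j)%N -> size s = n -> V j s = V J s.
  apply: upward_closed_acc => // j s ss; apply: Uup; rewrite /= ?ss // /seq_le /= leqnSn /=.
  by rewrite -/(seq_le s s); elim: (s) => //= a l; rewrite /seq_le /= leqnn.
pose c j m := count (predC (V j)) (compositions n m).
have cP j : eventually_poly (c j) by apply: IH.
pose g1 m := (\sum_(j <- iota 0 J) (if (j <= m)%N then c j (m - j) else 0))%N.
pose g2 m := (\sum_(i < m.+1) c J i)%N.
have h1 : eventually_poly g1.
  by apply: eventually_poly_sum => j; apply: eventually_poly_shift.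
have h2 : eventually_poly (fun m => if (J <= m)%N then g2 (m - J)%N else 0%N).
  by apply: eventually_poly_shift; apply: eventually_poly_psum.
apply: (@eventually_poly_eq _ _ J _ (eventually_poly_add h1 h2)) => m Jm.
rewrite compositionsS count_flatten -map_comp sumnE big_map Jm /=.
rewrite (eq_bigr (fun j => c j (m - j)%N)) => [|j _]; last by rewrite /= count_map.
have -> : (0 :: iota 1 m) = iota 0 J ++ iota J (m.+1 - J)%N.
  by rewrite -[LHS]/(iota 0 m.+1) -{1}(subnKC (leqW Jm)) iotaD.
rewrite big_cat /=; congr (_ + _)%N.
  rewrite /g1; rewrite !big_seq; apply: eq_bigr => j; rewrite mem_iota add0n => /andP[_ jJ].
  by rewrite (leq_trans (ltnW jJ)).
rewrite /g2 -subSn // -(big_mkord xpredT (c J)).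
have -> : iota J (m.+1 - J) = [seq (J + i)%N | i <- iota 0 (m.+1 - J)].
  by rewrite -iotaDl addn0.
rewrite big_map.
rewrite big_nat_rev /= /index_iota subn0 !big_seq; apply: eq_bigr => i; rewrite mem_iota => /andP[_].
rewrite add0n => im.
have -> : (0 + (m.+1 - J) - i.+1 = m - (J + i))%N by lia.
apply: eq_in_count => s; rewrite mem_compositions => /andP[/eqP ss _] /=.
by rewrite (VJ _ _ (leq_addr _ _)).
Qed.

(** * The Hilbert function is eventually polynomial *)

Section SubspaceOfPredicate.
Variables (K : fieldType) (vT : vectType K).

(** A subspace of maximal dimension among those contained in [P] absorbs every vector of [P]. *)
Lemma vspace_of_pred (P : vT -> Prop) :
  P 0 -> (forall a u v, P u -> P v -> P (a *: u + v)) ->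
  exists U : {vspace vT}, forall v, v \in U <-> P v.
Proof.
move=> P0 PD.
pose T k := `[< exists2 U : {vspace vT}, (forall v, v \in U -> P v) & \dim U = k >].
have exT : exists k, T k.
  exists 0%N; apply/asboolP; exists 0%VS; last exact: dimv0.
  by move=> v; rewrite memv0 => /eqP->.
have bT k : T k -> (k <= \dim {: vT})%N.
  by move=> /asboolP[U _ <-]; apply/dimvS/subvf.
case: (ex_maxnP exT bT) => k /asboolP[U UP Uk] kmax.
exists U => v; split; first exact: UP.
move=> Pv; apply: contrapT => /negP vU.
have : T k.+1.
  apply/asboolP; exists (U + <[v]>)%VS.
    move=> w /memv_addP[u uU [_ /vlineP[a ->] ->]].
    by rewrite addrC; apply: PD => //; exact: UP.
  rewrite dimv_disjoint_sum; last first.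
    apply/eqP; rewrite -subv0; apply/subvP => w; rewrite memv_cap memv0 => /andP[wU /vlineP[a wE]].
    rewrite wE; have [->|a0] := eqVneq a 0; first by rewrite scale0r.
    by move: vU; rewrite -[v](scalerK a0) -wE memvZ.
  have v0 : v != 0 by apply: contraNneq vU => ->; rewrite mem0v.
  by rewrite dim_vline v0 Uk addn1.
by move/kmax; rewrite ltnn.
Qed.

(** The dimension grows exactly when the next vector is not in the span of the previous ones.
    The predicate [std] records this by a criterion that does not refer to the list. *)
Lemma dim_greedy (T : eqType) (I : {vspace vT}) (x : T -> vT) (std : pred T) (L : seq T) :
  (forall L1 u L2, L = L1 ++ u :: L2 ->
     (x u \in (I + <<[seq x v | v <- L1]>>)%VS) = ~~ std u) ->
  \dim (I + <<[seq x v | v <- L]>>) = (\dim I + count std L)%N.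
Proof.
elim/last_ind: L => [|L u IH] H; first by rewrite span_nil addv0 addn0.
rewrite map_rcons -cats1 span_cat span_seq1 addvA -cats1 count_cat addnA -IH; last first.
  by move=> L1 w L2 LE; apply: (H _ _ (rcons L2 u)); rewrite LE rcons_cat.
have := H L u [::]; rewrite cats1 => /(_ erefl).
set V := (I + _)%VS; rewrite /= addn0.
case: (std u) => /= [/negbT xV|xV]; last by rewrite addn0; move/addv_idPl: (xV) => ->.
rewrite dimv_disjoint_sum.
  have x0 : x u != 0 by apply: contraNneq xV => ->; rewrite mem0v.
  by rewrite dim_vline x0.
apply/eqP; rewrite -subv0; apply/subvP => w; rewrite memv_cap memv0 => /andP[wU /vlineP[a wE]].
rewrite wE; have [->|a0] := eqVneq a 0; first by rewrite scale0r.
by move: xV; rewrite -[x u](scalerK a0) -wE memvZ.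
Qed.

End SubspaceOfPredicate.

Section Hilbert.
Variables (K : fieldType) (n : nat).
Implicit Types (X : set (proj K n)) (f g : {mpoly K[n.+1]}).

Definition vanishing X f := forall x, X x -> vanishes_at f x.

Lemma vanishing0 X : vanishing X 0.
Proof. by move=> x _ v _; rewrite meval0. Qed.

Lemma vanishingD X f g : vanishing X f -> vanishing X g -> vanishing X (f + g).
Proof. by move=> hf hg x Xx v vx; rewrite mevalD (hf x Xx v vx) (hg x Xx v vx) addr0. Qed.

Lemma vanishingM X f g : vanishing X f -> vanishing X (f * g).
Proof. by move=> hf x Xx v vx; rewrite mevalM (hf x Xx v vx) mul0r. Qed.

Lemma vanishingZ X a f : vanishing X f -> vanishing X (a *: f).
Proof. by move=> hf; rewrite -mul_mpolyC mulrC; exact: vanishingM. Qed.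

Lemma vanishing_vspace X m : exists I : {vspace dhomog n.+1 K m},
  forall f : dhomog n.+1 K m, f \in I <-> vanishing X (mpoly_of_dhomog f).
Proof.
apply: vspace_of_pred; first exact: vanishing0.
by move=> a u v hu hv; apply: vanishingD => //; exact: vanishingZ.
Qed.

Definition ideal_part X m := sval (cid (vanishing_vspace X m)).

Lemma ideal_partP X m (f : dhomog n.+1 K m) : f \in ideal_part X m <-> vanishing X (mpoly_of_dhomog f).
Proof. exact: (svalP (cid (vanishing_vspace X m))). Qed.

Definition hilbert_function X m := (\dim (fullv : {vspace dhomog n.+1 K m}) - \dim (ideal_part X m))%N.

Definition seq_mnm (s : seq nat) : 'X_{1..n.+1} := [multinom nth 0%N s i | i < n.+1].

Lemma seq_mnm_inj : {in [pred s | size s == n.+1] &, injective seq_mnm}.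
Proof.
move=> s t /eqP ss /eqP st /mnmP e; apply: (@eq_from_nth _ 0%N); first by rewrite ss st.
by move=> i; rewrite ss => lti; have := e (Ordinal lti); rewrite !mnmE.
Qed.

Lemma mdeg_seq_mnm s : size s = n.+1 -> mdeg (seq_mnm s) = sumn s.
Proof.
move=> ss; rewrite mdegE sumnE (big_nth 0%N) ss big_mkord.
by apply: eq_bigr => i _; rewrite mnmE.
Qed.

Lemma mem_seq_mnm_compositions m u : (u \in [seq seq_mnm s | s <- compositions n.+1 m]) = (mdeg u == m).
Proof.
apply/mapP/eqP => [[s]|<-].
  by rewrite mem_compositions => /andP[/eqP ss /eqP <-] ->; rewrite mdeg_seq_mnm.
exists (val (val u)); last by apply/mnmP => i; rewrite mnmE -mnm_nth.
by rewrite mem_compositions size_tuple eqxx /= /mdeg sumnE.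
Qed.

(** Membership in the initial ideal of [X] for the total order on monomials. *)
Definition is_leading X (u : 'X_{1..n.+1}) := `[< exists f,
  [/\ f \is (mdeg u).-homog, vanishing X f, f@_u = 1 & forall v, v \in msupp f -> (v <= u)%O] >].

Lemma is_leading_addm X u w : is_leading X u -> is_leading X (u + w)%MM.
Proof.
move=> /asboolP[f [fh fX fu fl]]; apply/asboolP; exists (f * 'X_[w]); split.
- by rewrite mdegD; apply: dhomogM => //; rewrite dhomogX.
- exact: vanishingM.
- by rewrite addmC mcoeffMX.
- move=> v; rewrite (perm_mem (msuppMX _ _)) => /mapP[v' /fl v'u ->].
  by rewrite [(w + v')%MM]addmC lemc_add2l.
Qed.

Definition dhomog_mnm m u : dhomog n.+1 K m := indhomog m 'X_[u].

Lemma val_dhomog_mnm m u : mdeg u = m -> mpoly_of_dhomog (dhomog_mnm m u) = 'X_[u].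
Proof.
move=> um; apply: (insubdK (0 : dhomog n.+1 K m)).
by rewrite -[_ \in _]/('X_[u] \is m.-homog) dhomogX; apply/eqP.
Qed.

(** Taken in increasing order, the monomials outside the initial ideal are those that are
    independent of the ideal and of the smaller monomials; so they form a basis of the quotient. *)
Lemma hilbert_function_count X m :
  hilbert_function X m = count (fun s => ~~ is_leading X (seq_mnm s)) (compositions n.+1 m).
Proof.
pose L := sort <=%O [seq seq_mnm s | s <- compositions n.+1 m].
have memL u : (u \in L) = (mdeg u == m) by rewrite mem_sort mem_seq_mnm_compositions.
have Luniq : uniq L.
  rewrite sort_uniq map_inj_in_uniq ?compositions_uniq // => s t.
  by rewrite !mem_compositions => /andP[ss _] /andP[st _]; apply: seq_mnm_inj.
have Lsort : sorted <%O L.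
  by rewrite lt_sorted_uniq_le Luniq; apply: sort_sorted; exact: le_total.
pose I := ideal_part X m.
have H L1 u L2 : L = L1 ++ u :: L2 ->
   (dhomog_mnm m u \in (I + <<[seq dhomog_mnm m v | v <- L1]>>)%VS) = ~~ ~~ is_leading X u.
  move=> LE; have um : mdeg u = m.
    by apply/eqP; rewrite -memL LE mem_cat mem_head orbT.
  have L1u v : v \in L1 -> (v < u)%O.
    move=> vL1; move: Lsort; rewrite LE lt_sorted_pairwise pairwise_cat.
    by move=> /andP[/allrelP/(_ v u vL1 (mem_head _ _))].
  have uL1 v : mdeg v = m -> (v < u)%O -> v \in L1.
    move=> vm vu; have : v \in L by rewrite memL vm.
    rewrite LE mem_cat inE => /or3P[//|/eqP vE|vL2]; first by rewrite vE ltxx in vu.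
    move: Lsort; rewrite LE lt_sorted_pairwise pairwise_cat => /and3P[_ _ /= /andP[/allP/(_ v vL2) uv _]].
    by have := lt_trans vu uv; rewrite ltxx.
  have L1m v : v \in L1 -> mdeg v = m.
    by move=> vL1; apply/eqP; rewrite -memL LE mem_cat vL1.
  rewrite negbK; apply/idP/idP.
    move=> /memv_addP[g /ideal_partP gX [h hL e]].
    have hsupp v : v \notin L1 -> (mpoly_of_dhomog h)@_v = 0.
      move=> vL1; rewrite (coord_span (X := in_tuple _) hL) !linear_sum big1 // => i _.
      have szi : (i < size L1)%N by rewrite -[size L1](size_map (dhomog_mnm m)); exact: ltn_ord.
      rewrite linearZ /= (nth_map 0%MM) //.
      rewrite val_dhomog_mnm ?L1m ?mem_nth // mcoeffX.
      by case: eqP => [ev|]; rewrite ?mulr0 //; rewrite -ev mem_nth in vL1.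
    have gE : mpoly_of_dhomog g = 'X_[u] - mpoly_of_dhomog h.
      by rewrite -(val_dhomog_mnm um) e raddfD addrK.
    apply/asboolP; exists (mpoly_of_dhomog g); split=> //.
    - by rewrite um; exact: dhomog_is_dhomog.
    - rewrite gE mcoeffB mcoeffX eqxx hsupp ?subr0 //.
      by apply/negP => /L1u; rewrite ltxx.
    - move=> v; rewrite mcoeff_msupp gE mcoeffB mcoeffX.
      case: (u =P v) => [-> //|_]; rewrite sub0r oppr_eq0 => hv.
      by apply/ltW/L1u; apply: contraNT hv => /hsupp ->.
  move=> /asboolP[f [fh fX fu fl]]; rewrite um in fh.
  pose F : dhomog n.+1 K m := DHomog fh.
  have -> : dhomog_mnm m u = F + (dhomog_mnm m u - F) by rewrite addrC subrK.
  apply: memv_add; first exact/ideal_partP.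
  have -> : dhomog_mnm m u - F = - \sum_(v <- msupp f | v != u) f@_v *: dhomog_mnm m v.
    apply: val_inj; rewrite [val _]raddfB [val (- _)]raddfN /= raddf_sum /= val_dhomog_mnm //.
    have usupp : u \in msupp f by rewrite mcoeff_msupp fu oner_neq0.
    rewrite {1}[f]mpolyE (bigD1_seq u) ?msupp_uniq //= fu scale1r opprD addrA subrr sub0r.
    congr (- _); rewrite big_seq_cond [in RHS]big_seq_cond; apply: eq_bigr => v /andP[vf _].
    by rewrite val_dhomog_mnm // (dhomog_mf fh vf).
  rewrite rpredN big_seq_cond; apply: rpred_sum => v /andP[vf vu].
  apply/rpredZ/memv_span/map_f/uL1; first exact: (dhomog_mf fh vf).
  by rewrite lt_neqAle vu fl.
have := dim_greedy H.
have -> : (I + <<[seq dhomog_mnm m v | v <- L]>>)%VS = fullv.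
  apply/eqP; rewrite eqEsubv subvf /=; apply/subvP => f _.
  apply: (subvP (addvSr _ _)).
  have -> : f = \sum_(v <- msupp (mpoly_of_dhomog f)) (mpoly_of_dhomog f)@_v *: dhomog_mnm m v.
    apply: val_inj; rewrite raddf_sum /= {1}[mpoly_of_dhomog f]mpolyE !big_seq; apply: eq_bigr => v vf.
    by rewrite val_dhomog_mnm // (dhomog_mf (dhomog_is_dhomog f) vf).
  rewrite big_seq; apply: rpred_sum => v vf; apply/rpredZ/memv_span/map_f.
  by rewrite memL (dhomog_mf (dhomog_is_dhomog f) vf).
rewrite /hilbert_function -/I => ->; rewrite addKn.
rewrite /L count_sort count_map; exact: eq_count.
Qed.

(** The exponents of the initial ideal form an upward closed set. *)
Theorem hilbert_function_poly X : eventually_poly (hilbert_function X).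
Proof.
apply: (@eventually_poly_eq _ _ 0%N _ (@count_outside_upward_closed n.+1 (fun s => is_leading X (seq_mnm s)) _)).
  by move=> m _; rewrite hilbert_function_count.
move=> s t ss st; have -> : seq_mnm t = (seq_mnm s + (seq_mnm t - seq_mnm s))%MM.
  rewrite addmC submK //; apply/mnm_lepP => i; rewrite !mnmE.
  move: st (nat_of_ord i); rewrite /seq_le; elim: (s) (t) {ss} => [|a s' IH] [|b t'] //=.
  by move=> /andP[ab st'] [|j] //=; apply: IH.
exact: is_leading_addm.
Qed.

End Hilbert.

(** * Leading terms from asymptotic bounds *)

(** For large arguments the leading term dominates the sum of all the others. *)
Lemma poly_ge0_lead (p : {poly rat}) m0 :
  (forall m, (m0 <= m)%N -> 0 <= p.[m%:R]) -> 0 <= lead_coef p.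
Proof.
move=> pge0; rewrite leNgt; apply/negP => lp.
have p0 : p != 0 by apply: contraTneq lp => ->; rewrite lead_coef0 ltxx.
pose n := (size p).-1.
have szp : size p = n.+1 by rewrite /n prednK // size_poly_gt0.
pose S := \sum_(i < n) `|p`_i|.
have Sge0 : 0 <= S by apply: sumr_ge0 => i _; apply: normr_ge0.
(* beyond [S / - lead_coef p] the leading term exceeds the sum of the others *)
pose m := (maxn m0 (Num.bound (S / - lead_coef p))).+1.
have mm0 : (m0 <= m)%N by rewrite /m; lia.
have m1 : 1 <= m%:R :> rat by rewrite ler1n.
have mS : S < - lead_coef p * m%:R.
  rewrite mulrC -ltr_pdivrMr ?oppr_gt0 //.
  apply: (lt_le_trans (archi_boundP _)); first by rewrite divr_ge0 // oppr_ge0 ltW.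
  by rewrite ler_nat leqW // leq_maxr.
have := pge0 m mm0; rewrite horner_coef szp big_ord_recr /= -/n -[p`_n]/(lead_coef p).
case: (posnP n) => [n0|n0].
  by rewrite big1 => [|i _]; [rewrite n0 add0r expr0 mulr1 leNgt lp | by move: (ltn_ord i); rewrite [X in (_ < X)%N]n0].
have le1 : \sum_(i < n) p`_i * m%:R ^+ i <= S * m%:R ^+ n.-1.
  rewrite mulr_suml; apply: ler_sum => i _.
  apply: le_trans (ler_norm _) _; rewrite normrM ler_wpM2l //.
  rewrite ger0_norm ?exprn_ge0 ?ler0n // ler_weXn2l //.
  by have := ltn_ord i; lia.
rewrite leNgt => /negP; apply; apply: le_lt_trans (lerD le1 (lexx _)) _.
rewrite -[in X in _ + X](prednK n0) exprS mulrA -mulrDl pmulr_llt0 ?exprn_gt0 ?ltr0n //.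
by rewrite -(opprK (_ * m%:R)) subr_lt0 -mulNr.
Qed.

(** Both [P - L] and [U - P] have a nonnegative leading coefficient. This bounds the degree of
    [P], and then its coefficient of degree [n] from both sides. *)
Lemma poly_sandwich (P L U : {poly rat}) n c m0 : c != 0 ->
  size L = n.+1 -> lead_coef L = c -> size U = n.+1 -> lead_coef U = c ->
  (forall m, (m0 <= m)%N -> L.[m%:R] <= P.[m%:R] <= U.[m%:R]) ->
  size P = n.+1 /\ lead_coef P = c.
Proof.
move=> c0 sL lL sU lU H.
have hL : 0 <= lead_coef (P - L).
  by apply: (@poly_ge0_lead _ m0) => m /H /andP[h _]; rewrite hornerD hornerN subr_ge0.
have hU : 0 <= lead_coef (U - P).
  by apply: (@poly_ge0_lead _ m0) => m /H /andP[_ h]; rewrite hornerD hornerN subr_ge0.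
have sP : (size P <= n.+1)%N.
  rewrite leqNgt; apply/negP => sP.
  rewrite lead_coefDl ?size_polyN ?sL // in hL.
  rewrite addrC lead_coefDl ?size_polyN ?sU // lead_coefN oppr_ge0 in hU.
  have /eqP : lead_coef P = 0 by apply/le_anti; rewrite hU hL.
  by rewrite lead_coef_eq0 => /eqP P0; rewrite P0 size_poly0 in sP.
have lead_n (A B : {poly rat}) : (size A <= n.+1)%N -> (size B <= n.+1)%N ->
    0 <= lead_coef (A - B) -> 0 <= (A - B)`_n.
  move=> sA sB h; have : (size (A - B)%R <= n.+1)%N.
    by rewrite (leq_trans (size_polyD _ _)) // size_polyN geq_max sA sB.
  rewrite leq_eqVlt => /orP[/eqP e|/leq_sizeP/(_ n (leqnn _)) -> //].
  by move: h; rewrite lead_coefE e.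
have cL : L`_n = c by rewrite -lL lead_coefE sL.
have cU : U`_n = c by rewrite -lU lead_coefE sU.
have cP : P`_n = c.
  apply/le_anti; rewrite -{1}cU -cL -subr_ge0 -coefB -[X in _ && X]subr_ge0 -coefB.
  by rewrite !lead_n ?sL ?sU.
have sPE : size P = n.+1.
  apply/eqP; rewrite eqn_leq sP ltnNge; apply/negP => sPn.
  by move: c0; rewrite -cP nth_default ?eqxx.
by split=> //; rewrite lead_coefE sPE.
Qed.

(** The binomial coefficient [C(2 m + s, Q)] as a polynomial in [m]. *)
Definition binomial_poly (s : rat) Q : {poly rat} :=
  Q`!%:R^-1 *: \prod_(i < Q) (2 *: 'X + (s - i%:R)%:P).

Lemma size_lin_factor (a b : rat) : a != 0 -> size (a *: 'X + b%:P) = 2%N /\ lead_coef (a *: 'X + b%:P) = a.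
Proof.
move=> a0; have sa : size (a *: 'X : {poly rat}) = 2%N by rewrite size_scale // size_polyX.
have sb : (size (b%:P) < size (a *: 'X : {poly rat})%R)%N by rewrite sa size_polyC; case: eqP.
by rewrite size_polyDl // lead_coefDl // sa lead_coefZ lead_coefX mulr1.
Qed.

Lemma size_binomial_poly s Q : size (binomial_poly s Q) = Q.+1 /\ lead_coef (binomial_poly s Q) = 2 ^+ Q / Q`!%:R.
Proof.
have f0 : Q`!%:R^-1 != 0 :> rat by rewrite invr_eq0 pnatr_eq0 -lt0n fact_gt0.
have two0 : (2 : rat) != 0 by [].
rewrite /binomial_poly size_scale // lead_coefZ mulrC; split.
  rewrite size_prod => [|i _]; last first.
    by rewrite -size_poly_gt0 (size_lin_factor _ two0).1.
  rewrite (eq_bigr (fun=> 2%N)) => [|i _]; last by rewrite (size_lin_factor _ two0).1.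
  by rewrite sum_nat_const card_ord; lia.
rewrite lead_coef_prod (eq_bigr (fun=> 2)) ?prodr_const ?card_ord // => i _.
exact: (size_lin_factor _ two0).2.
Qed.

Lemma horner_binomial_poly (s : rat) Q N m : (Q <= N)%N -> N%:R = 2 * m%:R + s ->
  (binomial_poly s Q).[m%:R] = 'C(N, Q)%:R.
Proof.
move=> QN NE; rewrite /binomial_poly hornerZ horner_prod.
rewrite (eq_bigr (fun i : 'I_Q => (N - i)%N%:R)) => [|i _]; last first.
  by rewrite !hornerE natrB ?NE ?addrA //; have := ltn_ord i; lia.
rewrite -natr_prod -ffact_prod -bin_ffact natrM mulrC mulfK //.
by rewrite pnatr_eq0 -lt0n fact_gt0.
Qed.

(** Both bounds have leading term [(2 m)^Q / (2 Q!)]; the shift by [e] only changes terms of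
    lower order. *)
Lemma half_binomial_sandwich (h : nat -> nat) (P : {poly rat}) Q e m0 : (0 < Q)%N ->
  (forall m, (m0 <= m)%N -> P.[m%:R] = (h m)%:R) ->
  (forall m, (m0 <= m)%N -> (2 * h m <= 'C(2 * m + 1 + Q, Q))%N) ->
  (forall m, (m0 <= m)%N -> ('C(2 * m + 1 + Q, Q) <= 2 * h (m + e).+1)%N) ->
  (2 ^ (Q - 1))%:R = ((size P).-1)`!%:R * lead_coef P.
Proof.
move=> Q0 PE hU hL.
pose c : rat := 2 ^+ Q.-1 / Q`!%:R.
have f0 : Q`!%:R != 0 :> rat by rewrite pnatr_eq0 -lt0n fact_gt0.
have cE : 2^-1 * (2 ^+ Q / Q`!%:R) = c.
  by rewrite -(prednK Q0) exprS /c prednK // mulrA mulKf.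
have h2 : (2^-1 : rat) != 0 by [].
(* the lower bound holds at [m + e + 1]: in terms of that argument its binomial coefficient is
   [C(2 m + Q - 1 - 2 e, Q)] *)
have [] := @poly_sandwich P (2^-1 *: binomial_poly (Q%:R - 1 - 2 * e%:R) Q)
  (2^-1 *: binomial_poly (1 + Q%:R) Q) Q c (m0 + e).+1.
- by rewrite /c mulf_neq0 ?invr_neq0 // expf_neq0.
- by rewrite size_scale // (size_binomial_poly _ _).1.
- by rewrite lead_coefZ (size_binomial_poly _ _).2.
- by rewrite size_scale // (size_binomial_poly _ _).1.
- by rewrite lead_coefZ (size_binomial_poly _ _).2.
- move=> m mm; rewrite PE; last by lia.
  rewrite ![(_ *: binomial_poly _ _).[_]]hornerZ; apply/andP; split.
    have [k mE] : exists k, m = (k + e).+1 by exists (m - e.+1)%N; lia.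
    rewrite (@horner_binomial_poly _ _ (2 * k + 1 + Q)) ; last 2 first.
    + by lia.
    + by rewrite mE -natr1 !natrD; lra.
    rewrite mulrC ler_pdivrMr // -natrM ler_nat [(h m * 2)%N]mulnC mE hL //; lia.
  rewrite (@horner_binomial_poly _ _ (2 * m + 1 + Q)); last 2 first.
  + by lia.
  + by rewrite !natrD; lra.
  by rewrite mulrC ler_pdivlMr // -natrM ler_nat [(h m * 2)%N]mulnC hU //; lia.
move=> -> ->; rewrite /c mulrC mulfVK //= natrX subn1 //.
Qed.

(** The left side grows like [m^s], the right side at most like [m^Q]. *)
Lemma binomial_growth s Q e :
  (forall m, 'C(m + s, s) <= 'C(2 * (e * m) + Q, Q))%N -> (s <= Q)%N.
Proof.
move=> H; rewrite leqNgt; apply/negP => Qs.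
(* the two bounds combine to [m ^ s <= A * m ^ Q], which fails for [m > A] *)
pose A := (s`! * (2 * e + Q) ^ Q)%N; pose m := A.+1.
have lo : (m ^ s <= 'C(m + s, s) * s`!)%N.
  rewrite bin_ffact ffact_prod -[X in (_ ^ X <= _)%N](card_ord s) -prod_nat_const.
  by apply: leq_prod => i _; have := ltn_ord i; lia.
have hi : ('C(2 * (e * m) + Q, Q) <= ((2 * e + Q) * m) ^ Q)%N.
  apply: (@leq_trans ((2 * (e * m) + Q) ^_ Q)%N).
    by rewrite -bin_ffact leq_pmulr // fact_gt0.
  rewrite ffact_prod -[X in (_ <= _ ^ X)%N](card_ord Q) -prod_nat_const.
  by apply: leq_prod => i _; rewrite /m; nia.
have : (m ^ s <= A * m ^ Q)%N.
  apply: leq_trans lo _; apply: (@leq_trans (((2 * e + Q) * m) ^ Q * s`!)%N).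
    by rewrite leq_mul2r (leq_trans (H m) hi) orbT.
  by rewrite expnMn /A; apply: eq_leq; ring.
rewrite leqNgt => /negP; apply; apply: (@leq_trans (m ^ Q.+1)).
  by rewrite expnS ltn_mul2r expn_gt0 ltnSn.
by rewrite leq_pexp2l.
Qed.

(** * Forms on projective sets and chains of irreducible sets *)

Lemma dhomog_hom (K : fieldType) n k i j (phi : {mpoly K[n.+1]} -> {mpoly K[k.+1]}) :
  linear phi -> (forall f, f \is i.-homog -> phi f \is j.-homog) ->
  exists g : 'Hom(dhomog n.+1 K i, dhomog k.+1 K j),
    forall f, mpoly_of_dhomog (g f) = phi (mpoly_of_dhomog f).
Proof.
move=> lphi hphi.
pose h (f : dhomog n.+1 K i) : dhomog k.+1 K j := DHomog (hphi _ (dhomog_is_dhomog f)).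
have lh : linear h by move=> c u v; apply: val_inj; rewrite /= lphi.
pose hM := GRing.isLinear.Build _ _ _ _ h lh.
pose hL : {linear _ -> _} := HB.pack h hM.
by exists (linfun hL) => f; rewrite lfunE.
Qed.

Lemma linear_mulr (K : fieldType) n (F : {mpoly K[n]}) : linear (fun f => f * F).
Proof. by move=> c u v; rewrite mulrDl scalerAl. Qed.

Lemma dim_dhomog (K : fieldType) n m :
  \dim (fullv : {vspace dhomog n.+1 K m}) = 'C(m + n, n).
Proof. by rewrite dimvf -[LHS]/('C(m + n, m)) -bin_sub ?leq_addr // addKn. Qed.

Section Projective.
Variables (K : fieldType) (n : nat).
Implicit Types (X Z : set (proj K n)) (f g F : {mpoly K[n.+1]}) (x : proj K n).

Lemma proj_line x : exists v, line x = <[v]>%VS.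
Proof.
case: x => U /= dU; exists (vpick U); apply/esym/eqP.
rewrite eqEdim -memvE memv_pick dim_vline vpick0 -dimv_eq0.
by move/eqP: dU => ->.
Qed.

Lemma meval_homog f e c (v : 'I_n.+1 -> K) : f \is e.-homog ->
  f.@[fun i => c * v i] = c ^+ e * f.@[v].
Proof.
move=> fh; rewrite !mevalE mulr_sumr !big_seq; apply: eq_bigr => u uf.
rewrite mulrCA; congr (_ * _).
under eq_bigr => i _ do rewrite exprMn.
by rewrite big_split /= prodrXr -mdegE (dhomog_mf fh uf).
Qed.

Lemma vanishes_atE f e x (v : 'rV[K]_n.+1) : f \is e.-homog -> line x = <[v]>%VS ->
  vanishes_at f x <-> f.@[fun i => v 0 i] = 0.
Proof.
move=> fh xE; split=> [|h w]; first by apply; rewrite xE memv_line.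
rewrite xE => /vlineP[c ->]; under meval_eq => i do rewrite mxE.
by rewrite (meval_homog _ _ fh) h mulr0.
Qed.

Lemma closed_in_vanishing Z f e : f \is e.-homog ->
  closed_in Z [set x | Z x /\ vanishes_at f x]%classic.
Proof.
move=> fh; exists [set x | vanishes_at f x]%classic; last by rewrite predeqE => x /=; split; case.
exists [set f]%classic; first by move=> _ ->; exists e.
by rewrite predeqE => x; split=> [h _ ->|] //; apply.
Qed.

(** The zero sets of [f] and [g] in [Z] are closed and cover it. *)
Lemma irreducible_vanishingM Z f g e e' : irreducible Z ->
  f \is e.-homog -> g \is e'.-homog -> vanishing Z (f * g) ->
  vanishing Z f \/ vanishing Z g.
Proof.
move=> [_ Zirr] fh gh fgZ.
have [|E|E] := Zirr _ _ (closed_in_vanishing Z fh) (closed_in_vanishing Z gh).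
- rewrite predeqE => x; split=> [Zx|[[]|[]] //].
  have [v xE] := proj_line x.
  have /(vanishes_atE (dhomogM fh gh) xE)/eqP := fgZ _ Zx.
  rewrite mevalM mulf_eq0 => /orP[/eqP|/eqP] h; [left|right]; split=> //; [exact/(vanishes_atE fh xE)|exact/(vanishes_atE gh xE)].
- by left => x; rewrite -E => -[].
- by right => x; rewrite -E => -[].
Qed.

Lemma irreducible_vanishingX Z f e j : irreducible Z -> f \is e.-homog ->
  vanishing Z (f ^+ j) -> vanishing Z f.
Proof.
move=> Zirr fh; elim: j => [|j IH].
  by rewrite expr0 => h; rewrite -[f]mul1r; apply: vanishingM.
rewrite exprS => /(irreducible_vanishingM Zirr fh (dhomogMn j fh)) [] //.
Qed.

Lemma nonempty_coordinate Z : irreducible Z -> exists i : 'I_n.+1, ~ vanishing Z 'X_i.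
Proof.
case=> [[x Zx] _]; have [v xE] := proj_line x.
have v0 : v != 0.
  by case: x xE {Zx} => U /= dU xE; apply: contraTneq dU => v0; rewrite xE v0 dim_vline eqxx.
have [i vi] : exists i, v 0 i != 0.
  apply: contrapT => h; move/eqP: v0; apply; apply/rowP => i; rewrite mxE.
  by apply: contrapT => vi; apply: h; exists i; apply/eqP.
exists i => /(_ x Zx v); rewrite xE memv_line mevalXU => /(_ isT) e.
by rewrite e eqxx in vi.
Qed.

(** As [Z] is irreducible, multiplication by [F] is injective on forms of degree [m] modulo
    those that vanish on [Z]. Its values vanish on [Z'], and the forms of degree [m + e] modulo
    those vanishing on [Z'] are a further quotient. *)
Lemma hilbert_step Z Z' F e m : irreducible Z -> (forall f, vanishing Z f -> vanishing Z' f) ->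
  F \is e.-homog -> vanishing Z' F -> ~ vanishing Z F ->
  (hilbert_function Z m + hilbert_function Z' (m + e) <= hilbert_function Z (m + e))%N.
Proof.
move=> Zirr ZZ' Fh FZ' FZ.
(* [mu] is multiplication by [F] *)
have [mu muE] := @dhomog_hom K n n m (m + e) _ (linear_mulr F) (fun f fh => dhomogM fh Fh).
have F0 : F != 0 by apply/eqP => F0; apply: FZ; rewrite F0; exact: vanishing0.
have kmu : lker mu = 0%VS.
  apply/eqP; rewrite -subv0; apply/subvP => f; rewrite memv_ker memv0 => /eqP/(congr1 (@mpoly_of_dhomog _ _ _)).
  by rewrite muE => /eqP; rewrite mulf_eq0 (negPf F0) orbF => f0; apply/eqP/val_inj/eqP.
pose I := ideal_part Z (m + e); pose J := ideal_part Z m; pose I' := ideal_part Z' (m + e).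
have dU : \dim (limg mu) = \dim {: dhomog n.+1 K m} by rewrite limg_dim_eq // kmu capv0.
have dJ : \dim (mu @: J) = \dim J by rewrite limg_dim_eq // kmu capv0.
have cap : (limg mu :&: I <= mu @: J)%VS.
  apply/subvP => f; rewrite memv_cap => /andP[/memv_imgP[g _ ->] /ideal_partP].
  rewrite muE => h; apply: memv_img; apply/ideal_partP.
  by have [] := irreducible_vanishingM Zirr (dhomog_is_dhomog g) Fh h.
have sum : (limg mu + I <= I')%VS.
  apply/subvP => f /memv_addP[_ /memv_imgP[g _ ->] [h /ideal_partP hI ->]].
  apply: rpredD; apply/ideal_partP; last exact: ZZ'.
  by rewrite muE mulrC; apply: vanishingM.
have := dimv_sum_cap (limg mu) I; have := dimvS cap; have := dimvS sum.
have := dimvS (subvf J); have := dimvS (subvf I); have := dimvS (subvf I').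
rewrite /hilbert_function -/I -/J -/I' dJ dU.
move: (\dim _) (\dim _) (\dim _) (\dim _) (\dim _) (\dim _) => a1 a2 a3 a4 a5 a6; lia.
Qed.

(** Each step of the chain adds one degree of growth: summing the inequality of
    [hilbert_step] over the multiples of [e] turns the bound for [i] into that for [i.+1] by
    Pascal's rule. *)
Lemma hilbert_chain (Z : nat -> set (proj K n)) (F : nat -> {mpoly K[n.+1]}) e s :
  (forall i, (i <= s)%N -> irreducible (Z i)) ->
  (forall i f, (i < s)%N -> vanishing (Z i.+1) f -> vanishing (Z i) f) ->
  (forall i, (i <= s)%N -> F i \is e.-homog) ->
  (forall i, (i < s)%N -> vanishing (Z i) (F i.+1)) ->
  (forall i, (i <= s)%N -> ~ vanishing (Z i) (F i)) ->
  forall i m, (i <= s)%N -> ('C(m + i, i) <= hilbert_function (Z i) (m * e))%N.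
Proof.
move=> Zirr Zinc Fh FZ FnZ; elim=> [|i IH] m si.
  rewrite bin0 subn_gt0 ltn_neqAle dimvS ?subvf // andbT.
  apply/eqP => E; have full : ideal_part (Z 0%N) (m * e) = fullv.
    by apply/eqP; rewrite eqEdim subvf /= E.
  have FZm : ~ vanishing (Z 0%N) (F 0%N ^+ m).
    elim: m {E full} => [|m IHm].
      rewrite expr0 => h; apply: (FnZ 0%N) => //.
      by rewrite -[F 0%N]mul1r; apply: vanishingM.
    rewrite exprS => /(irreducible_vanishingM (Zirr _ si) (Fh _ si) (dhomogMn m (Fh _ si))).
    by case=> //; apply: FnZ.
  have Fmh : F 0%N ^+ m \is (m * e).-homog by rewrite mulnC; apply: dhomogMn; apply: Fh.
  apply: FZm; apply/(ideal_partP (Z 0%N) (DHomog Fmh)).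
  by rewrite full memvf.
have {}IH m' := IH m' (ltnW si).
elim: m => [|m IHm].
  rewrite mul0n add0n binn; apply: (@leq_trans (hilbert_function (Z i) 0)).
    by have := IH 0%N; rewrite mul0n add0n binn.
  apply: leq_sub2l; apply: dimvS; apply/subvP => f /ideal_partP h; apply/ideal_partP.
  exact: Zinc.
have := hilbert_step (m * e) (Zirr _ si) (fun f => @Zinc i f si) (Fh _ si) (FZ _ si) (FnZ _ si).
rewrite -mulSnr; apply: leq_trans; rewrite addSn binS; apply: leq_add => //.
by rewrite -addSnnS; apply: IH.
Qed.

End Projective.

(** * Images of quadratic maps *)

(** It suffices to compare both sides when [p] is a monomial. *)
Lemma pihomogM (K : fieldType) n (f p : {mpoly K[n]}) d e : f \is d.-homog ->
  pihomog mdeg (d + e) (f * p) = f * pihomog mdeg e p.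
Proof.
move=> fh; rewrite [p]mpolyE mulr_sumr !linear_sum mulr_sumr; apply: eq_bigr => u _ /=.
rewrite -scalerAr !linearZ /= -scalerAr; congr (_ *: _).
have h : f * 'X_[u] \is (d + mdeg u)%N.-homog by apply: dhomogM => //; rewrite dhomogX.
rewrite pihomogX; case: eqP => [<-|ne]; first by rewrite pihomog_dE.
by rewrite mulr0 (pihomog_ne0 _ h) // eqn_add2l; apply/eqP.
Qed.

Section Pullback.
Variables (K : fieldType) (n k : nat) (lq : n.+1.-tuple {mpoly K[k.+1]}).
Hypothesis lqh : forall j, tnth lq j \is 2.-homog.

Lemma comp_homog f m : f \is m.-homog -> f \mPo lq \is (2 * m)%N.-homog.
Proof.
move=> fh; rewrite comp_mpolyEX big_seq; apply: rpred_sum => u uf; apply: rpredZ.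
rewrite comp_mpolyX -(dhomog_mf fh uf) /=.
rewrite mdegE big_distrr /=.
apply: (big_rec2 (fun d (p : {mpoly K[k.+1]}) => p \is d.-homog)); first exact: dhomog1.
by move=> i d p _ ph; apply: dhomogM => //; apply: dhomogMn.
Qed.

Lemma pihomog_comp f m : pihomog mdeg (2 * m) (f \mPo lq) = pihomog mdeg m f \mPo lq.
Proof.
rewrite [f]mpolyE (raddf_sum (comp_mpoly lq)) 2!(raddf_sum (pihomog mdeg _)) (raddf_sum (comp_mpoly lq)); apply: eq_bigr => u _ /=.
rewrite !linearZ /= pihomogX; congr (_ *: _).
have h : 'X_[u] \mPo lq \is (2 * mdeg u)%N.-homog by apply: comp_homog; rewrite dhomogX.
case: eqP => [<-|ne]; first by rewrite pihomog_dE.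
by rewrite comp_mpoly0 (pihomog_ne0 _ h) // eqn_mul2l; apply/eqP.
Qed.

Lemma linear_comp : linear (fun f : {mpoly K[n.+1]} => f \mPo lq).
Proof. by move=> a u v; rewrite linearP. Qed.

Lemma pullback_hom m : exists phi : 'Hom(dhomog n.+1 K m, dhomog k.+1 K (2 * m)),
  forall f, mpoly_of_dhomog (phi f) = mpoly_of_dhomog f \mPo lq.
Proof. exact: (dhomog_hom linear_comp (fun f => @comp_homog f m)). Qed.

Variable X : set (proj K n).
Hypothesis XE : forall f e, f \is e.-homog -> vanishing X f <-> f \mPo lq = 0.

(** The forms that vanish on [X] are the kernel of the pullback along [lq]. *)
Lemma hilbert_function_img m : exists W : {vspace dhomog k.+1 K (2 * m)},
  hilbert_function X m = \dim W /\
  forall w, w \in W <-> exists2 f, f \is m.-homog & mpoly_of_dhomog w = f \mPo lq.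
Proof.
have [phi phiE] := pullback_hom m; exists (limg phi); split.
  rewrite /hilbert_function; have <- : lker phi = ideal_part X m.
    apply/vspaceP => f; rewrite memv_ker; apply/eqP/idP.
      move=> /(congr1 (@mpoly_of_dhomog _ _ _)); rewrite phiE => h.
      by apply/ideal_partP; apply/(XE (dhomog_is_dhomog f)).
    move=> /ideal_partP /(XE (dhomog_is_dhomog f)) h.
    by apply: val_inj; rewrite /= phiE.
  by rewrite -(limg_ker_dim phi fullv) capfv addKn.
move=> w; split=> [/memv_imgP[f _ ->]|[f fh wE]].
  by exists (mpoly_of_dhomog f); rewrite ?phiE //; apply: dhomog_is_dhomog.
have -> : w = phi (DHomog fh) by apply: val_inj; rewrite /= phiE.
exact: memv_img (memvf _).
Qed.

Lemma hilbert_function_le m : (hilbert_function X m <= 'C(2 * m + k, k))%N.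
Proof.
have [W [-> _]] := hilbert_function_img m.
by rewrite -(dim_dhomog K) dimvS // subvf.
Qed.

(** Take forms that vanish on one member of the chain but not on the next one, and make their
    degrees equal to some [E] by taking powers. By [hilbert_chain] the Hilbert function
    of [X] at [m E] is at least [C(m + s, s)]; but it counts forms of degree [2 m E] in [k.+1]
    variables, so it grows at most like [m^k]. *)
Theorem chain_length_le s Z : irreducible_chain X s Z -> (s <= k)%N.
Proof.
move=> [Zcl Zlt].
have Zirr i : (i <= s)%N -> irreducible (Z i) by move=> /Zcl[].
have FP i : exists p : {mpoly K[n.+1]} * nat, (i <= s)%N -> [/\ p.1 \is p.2.-homog,
    (0 < p.2)%N, ~ vanishing (Z i) p.1 & forall j, i = j.+1 -> vanishing (Z j) p.1].
  have [si|//] := leqP i s; last by exists (0, 0%N).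
  case: i si => [|i] si.
    have [j jP] := nonempty_coordinate (Zirr _ si).
    by exists ('X_j, 1%N) => _; split=> //; rewrite dhomogX /= mdeg1.
  have [[A [S Sh AE] ZE] _] := Zcl _ (ltnW si).
  have [sub nsub] := Zlt _ si.
  have /existsNP[x /not_implyP[Zx nZx]] := nsub.
  have [[A1 _ Z1E] _] := Zcl _ si.
  have Xx : X x by move: Zx; rewrite Z1E => -[].
  have : ~ A x by move=> Ax; apply: nZx; rewrite ZE.
  rewrite AE /= => /existsNP[f /not_implyP[Sf nf]].
  have [e fh] := Sh _ Sf.
  have fZ : vanishing (Z i) f by move=> y; rewrite ZE AE => -[/(_ _ Sf)].
  exists (f, e) => _; split=> //=; last 2 first.
  - by move=> h; apply: nf; apply: h.
  - by move=> j [<-].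
  (* a constant that vanishes at a point of [Z i] is zero *)
  rewrite lt0n; apply/eqP => e0; apply: nf.
  have [[y Zy] _] := Zirr _ (ltnW si).
  rewrite e0 in fh; have fC : f = (f@_0%MM)%:MP.
    apply/mpolyP => u; rewrite mcoeffC; have [->|u0] := eqVneq u 0%MM; first by rewrite mulr1.
    by rewrite mulr0 (dhomog_nemf_coeff fh) // mdeg_eq0.
  have [v yE] := proj_line y.
  have := fZ y Zy v; rewrite yE memv_line fC mevalC => /(_ isT) f0.
  rewrite fC f0 => w _.
  by rewrite mevalC mcoeffC mul0r.
have [p pP] := boolp.choice FP.
pose E := (\prod_(i < s.+1) (p i).2)%N.
have Ediv i : (i <= s)%N -> (E %/ (p i).2 * (p i).2)%N = E.
  move=> si; apply: divnK; rewrite /E (bigD1 (Ordinal (si : (i < s.+1)%N))) //=.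
  exact: dvdn_mulr.
pose F i := (p i).1 ^+ (E %/ (p i).2)%N.
have Epos : (0 < E)%N.
  by apply: prodn_gt0 => i; case: (pP i) => //; rewrite -ltnS.
apply: (@binomial_growth s k E) => m.
have key := @hilbert_chain _ _ Z F E s Zirr.
have ZX i f : (i <= s)%N -> vanishing X f -> vanishing (Z i) f.
  by move=> si h x Zx; apply: h; case: (Zcl _ si) => -[A _ ZE] _; move: Zx; rewrite ZE => -[].
apply: leq_trans (key _ _ _ _ s m (leqnn s)) _.
- by move=> i f si h x Zx; apply: h; case: (Zlt _ si) => h _; apply: h.
- by move=> i si; rewrite /F -{2}(Ediv i si) mulnC; apply: dhomogMn; case: (pP i si).
- move=> i si; rewrite /F; have [_ e0 _ /(_ _ erefl) h] := pP _ si.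
  have : (0 < E %/ (p i.+1).2)%N by rewrite divn_gt0 // dvdn_leq // -(Ediv _ si) dvdn_mull.
  by case: (_ %/ _)%N => // j _; rewrite exprS; apply: vanishingM.
- move=> i si h; have [ph _ np _] := pP _ si.
  by apply: np; apply: irreducible_vanishingX (Zirr _ si) ph h.
apply: (@leq_trans (hilbert_function X (m * E))).
  apply/leq_sub2l/dimvS/subvP => f /ideal_partP h; apply/ideal_partP.
  exact: ZX.
by rewrite mulnC; apply: hilbert_function_le.
Qed.

End Pullback.

(** * Quadratic maps invariant under an involution *)

Section Involution.
Variables (K : fieldType) (k : nat) (s : 'I_k -> 'I_k).
Hypothesis sK : involutive s.

Definition permute_vars (f : {mpoly K[k]}) := f \mPo [tuple 'X_(s i) | i < k].

Lemma permute_varsX i : permute_vars 'X_i = 'X_(s i).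
Proof. by rewrite /permute_vars comp_mpolyXU -tnth_nth tnth_mktuple. Qed.

Lemma permute_vars_linear : linear permute_vars.
Proof. by move=> a u v; rewrite /permute_vars linearP. Qed.
HB.instance Definition _ := GRing.isLinear.Build K {mpoly K[k]} {mpoly K[k]} _
  permute_vars permute_vars_linear.

Lemma permute_varsM : {morph permute_vars : f g / f * g}.
Proof. by move=> f g; rewrite /permute_vars rmorphM. Qed.

Lemma permute_vars1 : permute_vars 1 = 1.
Proof. by rewrite /permute_vars comp_mpoly1. Qed.

Lemma meval_permute_vars f v : (permute_vars f).@[v] = f.@[fun i => v (s i)].
Proof.
by rewrite /permute_vars comp_mpoly_meval; apply: meval_eq => i; rewrite tnth_mktuple mevalXU.
Qed.

Lemma permute_vars_mnm u : permute_vars 'X_[u] = 'X_[[multinom u (s i) | i < k]].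
Proof.
rewrite /permute_vars comp_mpolyX mpolyXE_id (reindex_inj (inv_inj sK)) /=.
by apply: eq_bigr => i _; rewrite tnth_mktuple mnmE sK.
Qed.

Lemma mdeg_permute_mnm (u : 'X_{1..k}) : mdeg [multinom u (s i) | i < k] = mdeg u.
Proof.
rewrite !mdegE [in RHS](reindex_inj (inv_inj sK)) /=.
by apply: eq_bigr => i _; rewrite mnmE.
Qed.

Lemma permute_varsE f :
  permute_vars f = \sum_(u <- msupp f) f@_u *: 'X_[[multinom u (s i) | i < k]].
Proof.
rewrite {1}[f]mpolyE (raddf_sum permute_vars); apply: eq_bigr => u _ /=.
by rewrite linearZ /= permute_vars_mnm.
Qed.

Lemma permute_varsK : involutive permute_vars.
Proof.
move=> f; rewrite [permute_vars f]permute_varsE (raddf_sum permute_vars) [RHS]mpolyE.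
apply: eq_bigr => u _ /=; rewrite linearZ /= permute_vars_mnm; congr (_ *: 'X_[_]).
by apply/mnmP => i; rewrite !mnmE sK.
Qed.

Lemma permute_vars_homog f m : f \is m.-homog -> permute_vars f \is m.-homog.
Proof.
move=> fh; rewrite permute_varsE big_seq; apply: rpred_sum => u uf; apply: rpredZ.
by rewrite dhomogX /= mdeg_permute_mnm (dhomog_mf fh uf).
Qed.

End Involution.

(** Multiplication by a nonzero form is injective. *)
Lemma dim_mul_le (K : fieldType) n i j (F : {mpoly K[n.+1]}) e
    (U : {vspace dhomog n.+1 K i}) (V : {vspace dhomog n.+1 K j}) :
  F != 0 -> F \is e.-homog -> (i + e)%N = j ->
  (forall u (v : dhomog n.+1 K j), u \in U ->
     mpoly_of_dhomog v = mpoly_of_dhomog u * F -> v \in V) ->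
  (\dim U <= \dim V)%N.
Proof.
move=> F0 Fh ij UV.
have [|mu muE] := @dhomog_hom K n n i j _ (linear_mulr F).
  by move=> f fh; rewrite -ij; apply: dhomogM.
rewrite -(@limg_dim_eq _ _ _ mu).
  by apply/dimvS/subvP => _ /memv_imgP[u uU ->]; apply: UV uU (muE u).
apply/eqP; rewrite -subv0; apply/subvP => f.
rewrite memv_cap memv_ker memv0 => /andP[_ /eqP/(congr1 (@mpoly_of_dhomog _ _ _))].
by rewrite muE => /eqP; rewrite mulf_eq0 (negPf F0) orbF => f0; apply/eqP/val_inj/eqP.
Qed.

Section InvariantDim.
Variables (K : fieldType) (k : nat) (s : 'I_k.+1 -> 'I_k.+1).
Hypothesis sK : involutive s.
Hypothesis two_neq0 : (2%:R : K) != 0.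
Variable i0 : 'I_k.+1.
Hypothesis si0 : s i0 != i0.

Lemma eigen_space (c : K) m : exists U : {vspace dhomog k.+1 K m}, forall w : dhomog k.+1 K m,
  w \in U <-> permute_vars s (mpoly_of_dhomog w) = c *: mpoly_of_dhomog w.
Proof.
apply: vspace_of_pred => [|a u v]; first by rewrite !linear0.
by rewrite !linearP /= => -> ->.
Qed.

Definition inv_space m := sval (cid (eigen_space 1 m)).
Definition anti_space m := sval (cid (eigen_space (-1) m)).

Lemma inv_spaceP m (w : dhomog k.+1 K m) :
  w \in inv_space m <-> permute_vars s (mpoly_of_dhomog w) = mpoly_of_dhomog w.
Proof. by have := svalP (cid (eigen_space 1 m)) w; rewrite scale1r. Qed.

Lemma anti_spaceP m (w : dhomog k.+1 K m) :
  w \in anti_space m <-> permute_vars s (mpoly_of_dhomog w) = - mpoly_of_dhomog w.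
Proof. by have := svalP (cid (eigen_space (-1) m)) w; rewrite scaleN1r. Qed.

(** Every form is the sum of its invariant and its anti-invariant part. *)
Lemma dim_inv_anti m : (\dim (inv_space m) + \dim (anti_space m))%N = 'C(m + k, k).
Proof.
rewrite -dimv_disjoint_sum.
  rewrite -(dim_dhomog K); congr (\dim _); apply/eqP; rewrite eqEsubv subvf /=.
  apply/subvP => f _.
  pose g : dhomog k.+1 K m := DHomog (permute_vars_homog sK (dhomog_is_dhomog f)).
  have -> : f = 2%:R^-1 *: (f + g) + 2%:R^-1 *: (f - g).
    by rewrite -scalerDr addrACA subrr addr0 -mulr2n -scaler_nat scalerA mulVf // scale1r.
  apply: memv_add; apply: rpredZ.
    by apply/inv_spaceP; rewrite !raddfD /= permute_varsK // addrC.
  by apply/anti_spaceP; rewrite [mpoly_of_dhomog _]raddfB /= raddfB /= permute_varsK // opprB.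
apply/eqP; rewrite -subv0; apply/subvP => f; rewrite memv_cap memv0 => /andP[/inv_spaceP e /anti_spaceP].
rewrite e => /eqP; rewrite -addr_eq0 -mulr2n -scaler_nat scaler_eq0 (negPf two_neq0) /=.
by move=> f0; apply/eqP/val_inj/eqP.
Qed.

Let plus : {mpoly K[k.+1]} := 'X_i0 + 'X_(s i0).
Let minus : {mpoly K[k.+1]} := 'X_i0 - 'X_(s i0).

Let plus_neq0 : plus != 0.
Proof.
apply/eqP => /(congr1 (mcoeff U_(i0))) /eqP.
by rewrite /plus mcoeffD !mcoeffXU eqxx (negPf si0) addr0 mcoeff0 oner_eq0.
Qed.
Let minus_neq0 : minus != 0.
Proof.
apply/eqP => /(congr1 (mcoeff U_(i0))) /eqP.
by rewrite /minus mcoeffB !mcoeffXU eqxx (negPf si0) subr0 mcoeff0 oner_eq0.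
Qed.
Let X_homog i : ('X_i : {mpoly K[k.+1]}) \is 1.-homog.
Proof. by rewrite dhomogX /= mdeg1. Qed.
Let plus_homog : plus \is 1.-homog. Proof. by apply: rpredD; apply: X_homog. Qed.
Let minus_homog : minus \is 1.-homog. Proof. by apply: rpredB; apply: X_homog. Qed.
Let plus_inv : permute_vars s plus = plus.
Proof. by rewrite /plus raddfD /= !permute_varsX sK addrC. Qed.
Let minus_anti : permute_vars s minus = - minus.
Proof. by rewrite /minus raddfB /= !permute_varsX sK opprB. Qed.

(** The form ['X_i0 - 'X_(s i0)] is anti-invariant, so multiplying by it exchanges invariants
    and anti-invariants; this is why each of them makes up about half of all forms. *)
Lemma dim_inv_anti_le m : (\dim (inv_space m) <= \dim (anti_space m.+1))%N.
Proof.
apply: (dim_mul_le minus_neq0 minus_homog (addn1 m)) => u v /inv_spaceP uE vE.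
by apply/anti_spaceP; rewrite vE permute_varsM uE minus_anti mulrN.
Qed.

Lemma dim_anti_inv_le m : (\dim (anti_space m) <= \dim (inv_space m.+1))%N.
Proof.
apply: (dim_mul_le minus_neq0 minus_homog (addn1 m)) => u v /anti_spaceP uE vE.
by apply/inv_spaceP; rewrite vE permute_varsM uE minus_anti mulrNN.
Qed.

Lemma dim_inv_inv_le m : (\dim (inv_space m) <= \dim (inv_space m.+1))%N.
Proof.
apply: (dim_mul_le plus_neq0 plus_homog (addn1 m)) => u v /inv_spaceP uE vE.
by apply/inv_spaceP; rewrite vE permute_varsM uE plus_inv.
Qed.

Variables (n : nat) (lq : n.+1.-tuple {mpoly K[k.+1]}).
Hypothesis lqh : forall j, tnth lq j \is 2.-homog.
Hypothesis lqs : forall j, permute_vars s (tnth lq j) = tnth lq j.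
Variable X : set (proj K n).
Hypothesis XE : forall f e, f \is e.-homog -> vanishing X f <-> f \mPo lq = 0.

Lemma permute_vars_comp f : permute_vars s (f \mPo lq) = f \mPo lq.
Proof.
rewrite comp_mpolyEX (raddf_sum (permute_vars s)); apply: eq_bigr => u _ /=.
rewrite linearZ /=; congr (_ *: _); rewrite comp_mpolyX.
rewrite (big_morph _ (@permute_varsM _ _ s) (@permute_vars1 _ _ s)); apply: eq_bigr => i _.
elim: (u i) => [|j IH]; first by rewrite !expr0 permute_vars1.
by rewrite !exprS permute_varsM IH lqs.
Qed.

Variable g : {mpoly K[n.+1]}.
Hypothesis g_neq0 : g \mPo lq != 0.
Hypothesis g_cond : forall m f, f \is (2 * m).-homog -> permute_vars s f = f ->
  exists h, f * (g \mPo lq) = h \mPo lq.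

(** Pullbacks of forms of degree [m] are invariant of degree [2 m]; conversely a homogeneous
    component [G] of the pullback of [g] multiplies all invariants of even degree into pullbacks.
    So, up to a shift of the argument, the Hilbert function of [X] is the dimension of the
    invariants of degree [2 m], which is half of [C(2 m + k, k)] up to lower order terms. *)
Theorem degree_quadric_involution : has_degree X (2 ^ (k - 1)).
Proof.
have [e Ge] : exists e, pihomog mdeg e g \mPo lq != 0.
  apply: contrapT => h; move/eqP: g_neq0; apply.
  rewrite (pihomog_partitionE (leqnn (msize g))) raddf_sum big1 // => i _ /=.
  by apply: contrapT => /eqP ne; apply: h; exists i.
set G := _ \mPo lq in Ge.
have Gh : G \is (2 * e).-homog by apply: comp_homog => //; apply: pihomogP.
have Gf m f : f \is (2 * m).-homog -> permute_vars s f = f ->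
    exists2 h, h \is (m + e).-homog & f * G = h \mPo lq.
  move=> fh fs; have [h hE] := g_cond fh fs.
  exists (pihomog mdeg (m + e) h); first exact: pihomogP.
  by rewrite -pihomog_comp // -hE mulnDr pihomogM // pihomog_comp.
have k0 : (0 < k)%N.
  case: (posnP k) => // k0; move: si0; have n1 (i : 'I_k.+1) : nat_of_ord i = 0%N.
    by have := ltn_ord i; rewrite [X in (_ < X.+1)%N]k0; case: (nat_of_ord i).
  by rewrite -val_eqE /= !n1 eqxx.
have [P [m0 PE]] := hilbert_function_poly X.
exists P.
  exists m0 => m mm; exists (ideal_part X m); last exact: PE.
  exact: ideal_partP.
apply: (half_binomial_sandwich (e := e) k0 PE) => m _.
  have [W [-> WP]] := hilbert_function_img lqh XE m.
  have -> : (2 * m + 1 + k)%N = ((2 * m).+1 + k)%N by rewrite addn1.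
  have -> : (2 * \dim W = \dim W + \dim W)%N by rewrite mul2n addnn.
  rewrite -dim_inv_anti; apply: leq_add.
    apply: leq_trans (dim_inv_inv_le _); apply/dimvS/subvP => w /WP[f fh wE].
    by apply/inv_spaceP; rewrite wE permute_vars_comp.
  apply: leq_trans (dim_inv_anti_le _); apply/dimvS/subvP => w /WP[f fh wE].
  by apply/inv_spaceP; rewrite wE permute_vars_comp.
have [W [-> WP]] := hilbert_function_img lqh XE (m + e).+1.
have -> : (2 * m + 1 + k)%N = ((2 * m).+1 + k)%N by rewrite addn1.
(* the invariants of degree [2 m + 2] embed into the pullbacks by multiplication by [G] *)
have invW : (\dim (inv_space (2 * m).+2) <= \dim W)%N.
  apply: (dim_mul_le Ge Gh) => [|u v /inv_spaceP uE vE]; first by lia.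
  apply/WP; have [|h hh hE] := @Gf m.+1 (mpoly_of_dhomog u) _ uE.
    by rewrite mulnS; apply: dhomog_is_dhomog.
  by exists h; rewrite ?vE.
have -> : (2 * \dim W = \dim W + \dim W)%N by rewrite mul2n addnn.
  rewrite -dim_inv_anti; apply: leq_add; apply: leq_trans invW.
  exact: dim_inv_inv_le.
exact: dim_anti_inv_le.
Qed.

End InvariantDim.

(** * Finitely generated ideals and a weak Nullstellensatz *)

Section FiniteIdeal.
Variables (R : comNzRingType) (L : finType) (g : L -> R).

Definition gen_ideal (f : R) := exists r : L -> R, f = \sum_t r t * g t.

Lemma gen_ideal0 : gen_ideal 0.
Proof. by exists (fun=> 0); rewrite big1 // => t _; rewrite mul0r. Qed.

Lemma gen_idealD a b : gen_ideal a -> gen_ideal b -> gen_ideal (a + b).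
Proof.
move=> [r ->] [s ->]; exists (fun t => r t + s t); rewrite -big_split.
by apply: eq_bigr => t _; rewrite mulrDl.
Qed.

Lemma gen_idealM a b : gen_ideal b -> gen_ideal (a * b).
Proof.
move=> [r ->]; exists (fun t => a * r t); rewrite mulr_sumr.
by apply: eq_bigr => t _; rewrite mulrA.
Qed.

Lemma gen_ideal_gen t : gen_ideal (g t).
Proof.
exists (fun u => (u == t)%:R); rewrite (bigD1 t) //= eqxx mul1r big1 ?addr0 // => u /negPf ->.
by rewrite mul0r.
Qed.

Lemma gen_ideal_sum (I : Type) (s : seq I) (P : pred I) (F : I -> R) :
  (forall i, P i -> gen_ideal (F i)) -> gen_ideal (\sum_(i <- s | P i) F i).
Proof. by move=> FP; apply: big_ind => //; [exact: gen_ideal0|exact: gen_idealD]. Qed.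

Definition gen_radical f := exists N, gen_ideal (f ^+ N).

Lemma gen_radical0 : gen_radical 0.
Proof. by exists 1%N; rewrite expr1; exact: gen_ideal0. Qed.

Lemma gen_radicalM a b : gen_radical b -> gen_radical (a * b).
Proof. by move=> [N h]; exists N; rewrite exprMn; exact: gen_idealM. Qed.

(** In each term of the binomial expansion one of the two exponents is large enough. *)
Lemma gen_radicalD a b : gen_radical a -> gen_radical b -> gen_radical (a + b).
Proof.
move=> [M hM] [N hN]; exists (M + N)%N; rewrite exprDn; apply: gen_ideal_sum => i _.
rewrite -mulr_natl; apply: gen_idealM.
have [iN|Ni] := leqP i N.
  have -> : (M + N - i = (N - i) + M)%N by lia.
  by rewrite exprD mulrC mulrA; apply: gen_idealM.
by rewrite -(subnK (ltnW Ni)) exprD mulrA; apply: gen_idealM.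
Qed.

Lemma gen_radical_sum (I : Type) (s : seq I) (P : pred I) (F : I -> R) :
  (forall i, P i -> gen_radical (F i)) -> gen_radical (\sum_(i <- s | P i) F i).
Proof. by move=> FP; apply: big_ind => //; [exact: gen_radical0|exact: gen_radicalD]. Qed.

Lemma gen_radicalX a N : gen_radical (a ^+ N) -> gen_radical a.
Proof. by move=> [M h]; exists (N * M)%N; rewrite exprM. Qed.

End FiniteIdeal.

Definition is_ideal (R : comNzRingType) (I : R -> Prop) :=
  [/\ I 0, forall a b, I a -> I b -> I (a + b) & forall a b, I b -> I (a * b)].

Lemma gen_ideal_is_ideal (R : comNzRingType) (L : finType) (g : L -> R) : is_ideal (gen_ideal g).
Proof. by split; [exact: gen_ideal0|exact: gen_idealD|exact: gen_idealM]. Qed.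

(** Modulo [J] the entries of [T] are the scalars [v i]. *)
Lemma ideal_comp_sub_eval (K : fieldType) n m (J : {mpoly K[m]} -> Prop)
    (T : n.-tuple {mpoly K[m]}) (v : 'I_n -> K) :
  is_ideal J -> (forall i, J (tnth T i - (v i)%:MP)) ->
  forall f : {mpoly K[n]}, J ((f \mPo T) - (f.@[v])%:MP).
Proof.
move=> [J0 JD JM] Jv f.
elim/mpolyind: f => [|c u f _ _ IH]; first by rewrite meval0 comp_mpoly0 mpolyC0 subrr.
rewrite mevalD comp_mpolyD mpolyCD opprD addrACA; apply: (JD) => //.
rewrite mevalZ comp_mpolyZ mpolyCM -mul_mpolyC -mulrBr; apply: (JM).
rewrite mevalX comp_mpolyX rmorph_prod /=.
apply: (big_rec2 (fun a b => J (a - b))); first by rewrite subrr.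
move=> i a b _ Jab; rewrite rmorphXn /=.
have -> (x y : {mpoly K[m]}) : x * a - y * b = x * (a - b) + b * (x - y) by ring.
by apply: (JD); apply: (JM) => //; rewrite subrXX mulrC; apply: (JM); apply: Jv.
Qed.

Section Nullstellensatz.
Variables (K : closedFieldType) (n : nat).
Implicit Types (I : {mpoly K[n]} -> Prop).

Definition eval_at (p : {poly K}) (x : {mpoly K[n]}) := (map_poly (@mpolyC n K) p).[x].

Definition add_gen I x f := exists i r, I i /\ f = i + r * x.

Lemma add_gen_ideal I x : is_ideal I -> is_ideal (add_gen I x).
Proof.
move=> [I0 ID IM]; split.
- by exists 0, 0; rewrite mul0r addr0.
- move=> _ _ [i [r [Ii ->]]] [j [s [Ij ->]]]; exists (i + j), (r + s); split; first exact: ID.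
  by rewrite mulrDl addrACA.
- move=> a _ [i [r [Ii ->]]]; exists (a * i), (a * r); split; first exact: IM.
  by rewrite mulrDr mulrA.
Qed.

(** Let [c] be a root of [p = q (x - c)]. If [1] were in [I + (x - c)], then [q] would also
    take [x] into [I], and the degree can be lowered; a nonzero constant in [I] is impossible. *)
Lemma proper_add_root I x p : is_ideal I -> ~ I 1 -> p != 0 -> I (eval_at p x) ->
  exists c, ~ add_gen I (x - c%:MP) 1.
Proof.
move=> [I0 ID IM] I1; elim: {p}_.+1 {-2}p (ltnSn (size p)) => // s IH p sp p0 Ip.
have [sp1|] := boolP (size p == 1).
  case: I1; have /size_poly1P[c c0 pE] := sp1.
  have : I ((c^-1)%:MP * eval_at p x) by apply: IM.
  by rewrite pE /eval_at map_polyC hornerC /= -mpolyCM mulVf.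
move/closed_rootP => [c /factor_theorem[q pE]].
have [[i [r [Ii e1]]]|h] := pselect (add_gen I (x - c%:MP) 1); last by exists c.
have q0 : q != 0 by apply: contraNneq p0 => q0; rewrite pE q0 mul0r.
apply: (IH q) => //.
  by move: sp; rewrite pE size_Mmonic ?monicXsubC // size_XsubC addn2 ltnS.
rewrite -[eval_at q x]mulr1 e1 mulrDr; apply: ID; first exact: IM.
rewrite mulrCA; apply: IM.
by move: Ip; rewrite pE /eval_at rmorphM hornerM rmorphB /= map_polyX map_polyC !hornerE.
Qed.

(** Impose the equations ['X_i = v i] one variable at a time, keeping the ideal proper. In the
    end every [f] is congruent to the constant [f(v)], which must be zero if [f] is in [I]. *)
Lemma weak_nullstellensatz I : is_ideal I -> ~ I 1 ->
  (forall i, exists2 p, p != 0 & I (eval_at p 'X_i)) ->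
  exists v, forall f, I f -> f.@[v] = 0.
Proof.
move=> Iid I1 Ialg.
have [J [v [Jid J1 IJ Jv]]] : exists J v, [/\ is_ideal J, ~ J 1, forall f, I f -> J f &
    forall i, i \in enum 'I_n -> J ('X_i - (v i : K)%:MP)].
  elim: (enum 'I_n) => [|i s [J [v [Jid J1 IJ Jv]]]].
    by exists I, (fun=> 0); split.
  have [p p0 Ip] := Ialg i.
  have [c cP] := proper_add_root Jid J1 p0 (IJ _ Ip).
  exists (add_gen J ('X_i - c%:MP)), (fun j => if j \in s then v j else c); split=> //.
  - exact: add_gen_ideal.
  - by move=> f /IJ Jf; exists f, 0; rewrite mul0r addr0.
  - move=> j; rewrite inE; case: ifP => [js _|js /orP[/eqP->|//]].
      by exists ('X_j - (v j)%:MP), 0; rewrite mul0r addr0; split=> //; exact: Jv.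
    by exists 0, 1; rewrite mul1r add0r; split=> //; case: Jid.
have [J0 JD JM] := Jid.
have JB f : J (f - (f.@[v])%:MP).
  rewrite -[X in X - _]comp_mpoly_id; apply: ideal_comp_sub_eval => // i.
  by rewrite tnth_mktuple; apply: Jv; rewrite mem_enum.
exists v => f If; apply/eqP; apply: contrapT => /negP f0; apply: J1.
have : J ((f.@[v])^-1%:MP * (f + -1 * (f - f.@[v]%:MP))).
  by apply/JM/JD; [exact: IJ|exact: JM].
by rewrite mulN1r opprB addrC subrK -mpolyCM mulVf.
Qed.

End Nullstellensatz.

(** * Finiteness over the autocorrelations *)

Section Autocorrelation.
Variables (K : fieldType) (k : nat) (L : finType) (d : 'I_k.+1 -> 'I_k.+1 -> L).

Definition autocor (t : L) : {mpoly K[k.+1]} :=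
  \sum_i \sum_(j | d i j == t) 'X_i * 'X_j.

Lemma autocor_homog t : autocor t \is 2.-homog.
Proof.
apply: rpred_sum => i _; apply: rpred_sum => j _.
by rewrite -mpolyXD dhomogX /= mdegD !mdeg1.
Qed.

Lemma meval_autocor t v : (autocor t).@[v] = \sum_i \sum_(j | d i j == t) v i * v j.
Proof.
rewrite raddf_sum; apply: eq_bigr => i _; rewrite raddf_sum; apply: eq_bigr => j _ /=.
by rewrite mevalM !mevalXU.
Qed.

Variable w : 'I_k.+1 -> nat.
Hypothesis w_inj : injective w.
Hypothesis dw : forall i j i' j', d i j = d i' j' -> (w j + w i' = w j' + w i)%N.

(** Compare [('X_i * 'X_j) ^+ 2] with ['X_i * 'X_j] times the autocorrelation at the lag
    [d i j]. The other terms are ['X_i * 'X_j * 'X_i' * 'X_j'] with the same lag; if [w i' < w i]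
    the factor ['X_i' * 'X_j'] is known to be in the radical, and otherwise [w j' > w j] and
    ['X_i * 'X_j'] is. So one inducts upwards on [w i] and downwards on [w j]. *)
Lemma autocor_radical i j : gen_radical autocor ('X_i * 'X_j).
Proof.
have [M wM] : exists M, forall i, (w i <= M)%N.
  by exists (\max_i w i)%N => l; apply: leq_bigmax.
have key a : forall b i j, (w i < a)%N -> (M - w j < b)%N -> gen_radical autocor ('X_i * 'X_j).
  elim: a => // a IHa; elim=> // b IHb {}i {}j ia jb.
  apply: (@gen_radicalX _ _ _ _ 2).
  have -> : ('X_i * 'X_j) ^+ 2 = 'X_i * 'X_j * autocor (d i j) +
     (-1) * \sum_(p : 'I_k.+1 * 'I_k.+1 | (d p.1 p.2 == d i j) && (p != (i, j)))
        'X_i * 'X_j * ('X_p.1 * 'X_p.2).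
    rewrite /autocor pair_big_dep /= (bigD1 (i, j)) ?eqxx //= mulrDr mulr_sumr.
    by rewrite mulN1r addrK expr2.
  apply: gen_radicalD.
    by exists 1%N; rewrite expr1; apply: gen_idealM; exact: gen_ideal_gen.
  apply/gen_radicalM/gen_radical_sum => -[i' j'] /= /andP[/eqP dd ne].
  have e := dw dd.
  have [lt|lt|eqw] := ltngtP (w i') (w i).
  - apply: gen_radicalM; apply: (IHa (M - w j').+1) => //.
    exact: leq_trans lt _.
  - rewrite [X in gen_radical _ X](_ : _ = 'X_j * 'X_i' * ('X_i * 'X_j')); last by ring.
    apply: gen_radicalM; apply: IHb => //.
    by have := wM j'; lia.
  - have ii := w_inj eqw; have jj : j' = j by apply: w_inj; lia.
    by move: ne; rewrite ii jj eqxx.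
exact: (key (w i).+1 (M - w j).+1).
Qed.

(** A monomial of large degree contains a high power of some variable. *)
Lemma monomial_autocor_ideal :
  exists D, forall u : 'X_{1..k.+1}, (D <= mdeg u)%N -> gen_ideal autocor 'X_[u].
Proof.
have Xrad i : exists N, gen_ideal autocor ('X_i ^+ N).
  have [N h] := autocor_radical i i; exists (2 * N)%N.
  by rewrite exprM expr2.
have [N NP] := boolp.choice Xrad.
exists (\sum_i N i).+1 => u Du.
have [i Ni] : exists i, (N i <= u i)%N.
  apply: contrapT => h; move: Du; rewrite ltnNge => /negP; apply.
  rewrite mdegE; apply: leq_sum => i _; apply: ltnW; rewrite ltnNge; apply/negP => Ni.
  by apply: h; exists i.
have -> : u = ((u - U_(i) *+ N i) + U_(i) *+ N i)%MM.
  rewrite submK //; apply/mnm_lepP => j; rewrite mulmnE mnm1E.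
  by case: eqP => [<-|]; rewrite ?mul1n ?mul0n.
by rewrite mpolyXD -mpolyXn; apply: gen_idealM.
Qed.

Variables (n : nat) (lag : 'I_n.+1 -> L) (idx : L -> 'I_n.+1).
Hypothesis idxP : forall t, autocor (lag (idx t)) = autocor t.

Definition autocor_tuple := [tuple autocor (lag j) | j < n.+1].
Notation gam := autocor_tuple.

Lemma autocor_tuple_homog j : tnth gam j \is 2.-homog.
Proof. by rewrite tnth_mktuple; exact: autocor_homog. Qed.

Lemma comp_idx t : 'X_(idx t) \mPo gam = autocor t.
Proof. by rewrite comp_mpolyXU -tnth_nth tnth_mktuple. Qed.

(** A monomial of large degree is a combination of the autocorrelations with coefficients in
    degree smaller by two, where induction applies. *)
Lemma finite_over_autocor : exists D, forall f : {mpoly K[k.+1]},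
  exists b : 'X_{1..k.+1 < D} -> {mpoly K[n.+1]}, f = \sum_u (b u \mPo gam) * 'X_[u].
Proof.
(* two more than necessary, so that the degree two of an autocorrelation can be subtracted *)
have [D0 D0P] := monomial_autocor_ideal; pose D := D0.+2; exists D.
pose T (f : {mpoly K[k.+1]}) :=
  exists b : 'X_{1..k.+1 < D} -> {mpoly K[n.+1]}, f = \sum_u (b u \mPo gam) * 'X_[u].
have T0 : T 0 by exists (fun=> 0); rewrite big1 // => u _; rewrite comp_mpoly0 mul0r.
have TD f g : T f -> T g -> T (f + g).
  move=> [b ->] [c ->]; exists (fun u => b u + c u); rewrite -big_split.
  by apply: eq_bigr => u _; rewrite comp_mpolyD mulrDl.
have TM a f : T f -> T ((a \mPo gam) * f).
  move=> [b ->]; exists (fun u => a * b u); rewrite mulr_sumr.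
  by apply: eq_bigr => u _; rewrite rmorphM mulrA.
have Tsum (I : Type) (r : seq I) (P : pred I) (F : I -> {mpoly K[k.+1]}) :
    (forall i, P i -> T (F i)) -> T (\sum_(i <- r | P i) F i).
  by move=> FP; apply: big_ind.
have TX u : T 'X_[u].
  have [m] := ubnP (mdeg u); elim: m u => // m IH u um.
  have [uD|Du] := ltnP (mdeg u) D.
    exists (fun v => (BMultinom uD == v)%:R); rewrite (bigD1 (BMultinom uD)) //= eqxx.
    rewrite comp_mpoly1 mul1r big1 ?addr0 // => v; rewrite eq_sym => /negPf ->.
    by rewrite comp_mpoly0 mul0r.
  have [r rE] : gen_ideal autocor 'X_[u] by apply: D0P; apply: leq_trans Du; rewrite /D; lia.
  have uE : mdeg u = (2 + (mdeg u - 2))%N by rewrite subnKC //; apply: leq_trans Du.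
  have -> : 'X_[u] = \sum_t (autocor t) * pihomog mdeg (mdeg u - 2) (r t).
    have uh : ('X_[u] : {mpoly K[k.+1]}) \is (mdeg u).-homog by rewrite dhomogX.
    rewrite -[LHS](pihomog_dE uh).
    rewrite rE (raddf_sum (pihomog mdeg _)); apply: eq_bigr => t _ /=.
    by rewrite mulrC {1}uE pihomogM //; apply: autocor_homog.
  apply: (Tsum) => t _; rewrite -comp_idx; apply: (TM).
  rewrite pihomogE; apply: (Tsum) => v /eqP vm.
  rewrite -mul_mpolyC -[_%:MP](comp_mpolyC _ gam); apply: (TM); apply: IH.
  by rewrite vm; move: Du; rewrite /D; lia.
move=> f; rewrite -/(T f) [f]mpolyE; apply: (Tsum) => u _.
by rewrite -mul_mpolyC -[_%:MP](comp_mpolyC _ gam); apply: (TM).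
Qed.

End Autocorrelation.

(** * A conductor from a single fibre *)

Section Conductor.
Variables (K : closedFieldType) (k : nat) (L : finType) (d : 'I_k.+1 -> 'I_k.+1 -> L).
Variables (n : nat) (lag : 'I_n.+1 -> L) (idx : L -> 'I_n.+1).
Local Notation Gam := (autocor K d).
Hypothesis idxP : forall t, Gam (lag (idx t)) = Gam t.
Local Notation gam := (autocor_tuple K d lag).
Variable D : nat.
Hypothesis finD : forall f : {mpoly K[k.+1]},
  exists b : 'X_{1..k.+1 < D} -> {mpoly K[n.+1]}, f = \sum_u (b u \mPo gam) * 'X_[u].

Variable P : 'I_k.+1 -> K.
Let c t := (Gam t).@[P].

Definition fibre_ideal := gen_ideal (fun t => Gam t - (c t)%:MP).

Lemma comp_fibre (b : {mpoly K[n.+1]}) :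
  fibre_ideal ((b \mPo gam) - (b.@[fun j => c (lag j)])%:MP).
Proof.
apply: ideal_comp_sub_eval; first exact: gen_ideal_is_ideal.
by move=> j; rewrite tnth_mktuple; exact: (gen_ideal_gen (fun t => Gam t - (c t)%:MP)).
Qed.

(** Modulo the ideal every polynomial is a linear combination of finitely many monomials, so
    sufficiently many powers of [x] are linearly dependent. *)
Lemma fibre_algebraic (x : {mpoly K[k.+1]}) : exists2 p, p != 0 & fibre_ideal (eval_at p x).
Proof.
have [I0 ID IM] := gen_ideal_is_ideal (fun t => Gam t - (c t)%:MP).
pose U : finType := 'X_{1..k.+1 < D}.
have red f : exists a : U -> K, fibre_ideal (f - \sum_(u : U) a u *: 'X_[u]).
  have [b ->] := finD f; exists (fun u => (b u).@[fun j => c (lag j)]).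
  rewrite -sumrB; apply: gen_ideal_sum => u _.
  by rewrite -mul_mpolyC -mulrBl mulrC; apply: (IM); exact: comp_fibre.
have [a aP] := boolp.choice (fun i : 'I_#|U|.+1 => red (x ^+ i)).
pose A := \matrix_(i < #|U|.+1, j < #|U|) a i (enum_val j).
(* there is one more power than there are monomials *)
have [v v0 vA] : exists2 v : 'rV_(#|U|.+1), v != 0 & v *m A = 0.
  have : ~~ row_free A by rewrite /row_free neq_ltn ltnS rank_leq_col.
  rewrite -kermx_eq0 => /rowV0Pn[v vk v0]; exists v => //.
  exact/sub_kermxP.
exists (\poly_(i < #|U|.+1) v 0 (inord i)).
  apply: contraNneq v0 => /polyP p0; apply/eqP/rowP => i; rewrite mxE.
  by have := p0 i; rewrite coef_poly ltn_ord inord_val coef0.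
rewrite /eval_at poly_def raddf_sum /= horner_sum.
rewrite [X in fibre_ideal X](_ : _ = \sum_(i < #|U|.+1) (v 0 i)%:MP * (x ^+ i - \sum_(u : U) a i u *: 'X_[u])).
  by apply: gen_ideal_sum => i _; apply: (IM); exact: aP.
under [RHS]eq_bigr do rewrite mulrBr.
rewrite sumrB [X in _ - X](_ : _ = 0) ?subr0.
  apply: eq_bigr => i _; rewrite map_polyZ hornerZ map_polyXn hornerXn inord_val //.
under eq_bigr do rewrite mulr_sumr.
rewrite exchange_big big1 // => u _.
move/rowP: vA => /(_ (enum_rank u)); rewrite !mxE => vA.
transitivity ((\sum_j v 0 j * A j (enum_rank u))%:MP * 'X_[u] : {mpoly K[k.+1]}).
  rewrite rmorph_sum mulr_suml; apply: eq_bigr => i _ /=.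
  by rewrite mxE enum_rankK mpolyCM -mul_mpolyC mulrA.
by rewrite vA mpolyC0 mul0r.
Qed.

(** The differential of the autocorrelation at [Q] in the direction [b]. *)
Definition bilinear_autocor (Q b : 'I_k.+1 -> K) t : K :=
  \sum_i \sum_(j | d i j == t) (Q i * b j + b i * Q j).

(** Nakayama's lemma in explicit form. With [y = X - Q], injectivity of the differential allows
    one to combine the equations of the fibre into [y *m (1 + E)] where [E] vanishes at [Q];
    multiplying by the adjugate shows that [r = det (1 + E)] takes all [y i] into the ideal. *)
Lemma unramified (Q : 'I_k.+1 -> K) : (forall t, (Gam t).@[Q] = c t) ->
  (forall b, (forall t, bilinear_autocor Q b t = 0) -> forall i, b i = 0) ->
  exists2 r : {mpoly K[k.+1]}, r.@[Q] = 1 & forall i, fibre_ideal (r * ('X_i - (Q i)%:MP)).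
Proof.
move=> Qc Qinj.
pose J := \matrix_(l < k.+1, t < #|L|) bilinear_autocor Q (fun i => (i == l)%:R) (enum_val t).
have JE b t : \sum_l b l * J l (enum_rank t) = bilinear_autocor Q b t.
  under eq_bigr do rewrite mxE enum_rankK mulr_sumr.
  rewrite exchange_big; apply: eq_bigr => i _.
  under eq_bigr do rewrite mulr_sumr.
  rewrite exchange_big; apply: eq_bigr => j _.
  under eq_bigr do rewrite mulrDr mulrCA [X in _ + X]mulrA.
  rewrite big_split /= -mulr_sumr -mulr_suml; congr (_ * _ + _ * _).
    rewrite (bigD1 j) //= eqxx mulr1 big1 ?addr0 // => l /negPf.
    by rewrite eq_sym => ->; rewrite mulr0.
  rewrite (bigD1 i) //= eqxx mulr1 big1 ?addr0 // => l /negPf.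
  by rewrite eq_sym => ->; rewrite mulr0.
have /row_freeP[C JC] : row_free J.
  rewrite -kermx_eq0; apply/rowV0P => v /sub_kermxP vJ; apply/rowP => i; rewrite [RHS]mxE.
  apply: (Qinj (v 0)) => t; rewrite -JE.
  by move/rowP: vJ => /(_ (enum_rank t)); rewrite !mxE.
pose y i : {mpoly K[k.+1]} := 'X_i - (Q i)%:MP.
pose m l t := \sum_(j | d l j == t) y j.
(* Taylor expansion of the quadric at [Q], the second order part being divided by [y] *)
have GE t : Gam t - (c t)%:MP = \sum_l y l * ((J l (enum_rank t))%:MP + m l t).
  under eq_bigr do rewrite mulrDr.
  rewrite big_split /=.
  have -> : \sum_l y l * (J l (enum_rank t))%:MP =
    \sum_i \sum_(j | d i j == t) ((Q i)%:MP * y j + y i * (Q j)%:MP).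
    under eq_bigr do rewrite mxE enum_rankK rmorph_sum mulr_sumr.
    rewrite exchange_big; apply: eq_bigr => i _ /=.
    under eq_bigr do rewrite rmorph_sum mulr_sumr.
    rewrite exchange_big; apply: eq_bigr => j _ /=.
    under eq_bigr do rewrite mpolyCD mulrDr !mpolyCM mulrCA [X in _ + X]mulrA.
    rewrite big_split /= -mulr_sumr -mulr_suml; congr (_ * _ + _ * _).
      rewrite (bigD1 j) //= eqxx mulr1 big1 ?addr0 // => l /negPf.
      by rewrite eq_sym => ->; rewrite mulr0.
    rewrite (bigD1 i) //= eqxx mulr1 big1 ?addr0 // => l /negPf.
    by rewrite eq_sym => ->; rewrite mulr0.
  rewrite -big_split /= -Qc meval_autocor rmorph_sum -sumrB; apply: eq_bigr => i _ /=.
  rewrite rmorph_sum mulr_sumr -sumrB -big_split /=; apply: eq_bigr => j _.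
  by rewrite mpolyCM /y; ring.
pose E := \matrix_(l < k.+1, i < k.+1) \sum_t (C (enum_rank t) i)%:MP * m l t.
pose Y := \row_i y i.
have YE i : fibre_ideal ((Y *m (1%:M + E)) 0 i).
  rewrite [X in fibre_ideal X](_ : _ = \sum_t (C (enum_rank t) i)%:MP * (Gam t - (c t)%:MP)).
    apply: gen_ideal_sum => t _; apply: gen_idealM.
    exact: (gen_ideal_gen (fun t => Gam t - (c t)%:MP)).
  rewrite mxE; under [RHS]eq_bigr do rewrite GE mulr_sumr.
  rewrite exchange_big; apply: eq_bigr => l _ /=; rewrite !mxE.
  under [RHS]eq_bigr do rewrite mulrCA.
  rewrite -mulr_sumr; congr (_ * _).
  under [RHS]eq_bigr do rewrite mulrDr -mpolyCM.
  rewrite big_split /= -rmorph_sum; congr (_ + _).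
  move/matrixP: JC => /(_ l i); rewrite !mxE => JC.
  rewrite -[LHS](rmorph_nat (@mpolyC k.+1 K)) -JC; congr (_%:MP).
  rewrite (reindex (@enum_rank L)); first by apply: eq_bigr => t _; exact: mulrC.
  exact: onW_bij _ (Bijective (@enum_rankK L) (@enum_valK L)).
pose r := \det (1%:M + E); exists r.
  rewrite /r -det_map_mx /= raddfD /= map_scalar_mx /= rmorph1.
  rewrite [X in 1%:M + X](_ : _ = 0) ?addr0 ?det1 //.
  apply/matrixP => l i; rewrite !mxE raddf_sum big1 // => t _ /=.
  rewrite mevalM raddf_sum /= big1 ?mulr0 // => j _.
  by rewrite /y mevalB mevalXU mevalC subrr.
move=> i.
have : (Y *m (1%:M + E) *m \adj (1%:M + E)) 0 i = r * y i.
  by rewrite -mulmxA mul_mx_adj mul_mx_scalar !mxE.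
move=> <-; rewrite mxE; apply: gen_ideal_sum => l _.
by rewrite mulrC; apply: gen_idealM; exact: YE.
Qed.

Hypothesis fibre_inj : forall Q : 'I_k.+1 -> K, (forall t, (Gam t).@[Q] = c t) ->
  forall b, (forall t, bilinear_autocor Q b t = 0) -> forall i, b i = 0.

(** The [r] with [r * f] in the ideal form an ideal without zeros: a zero would be a point [Q]
    of the fibre, while [unramified] provides such an [r] with value [1] at [Q]. *)
Lemma fibre_reduced f : (forall Q, (forall t, (Gam t).@[Q] = c t) -> f.@[Q] = 0) -> fibre_ideal f.
Proof.
move=> f0; have [I0 ID IM] := gen_ideal_is_ideal (fun t => Gam t - (c t)%:MP).
pose I r := fibre_ideal (r * f).
have Iid : is_ideal I.
  split; rewrite /I; first by rewrite mul0r.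
    by move=> a b ha hb; rewrite mulrDl; apply: ID.
  by move=> a b hb; rewrite -mulrA; apply: IM.
have subI r : fibre_ideal r -> I r by move=> h; rewrite /I mulrC; apply: IM.
have [I1|I1] := pselect (I 1); first by rewrite -[f]mul1r.
have Ialg i : exists2 p, p != 0 & I (eval_at p 'X_i).
  by have [p p0 /subI h] := fibre_algebraic 'X_i; exists p.
have [Q QI] := weak_nullstellensatz Iid I1 Ialg.
have Qc t : (Gam t).@[Q] = c t.
  apply/eqP; rewrite -subr_eq0 -[X in _ - X](mevalC Q) -mevalB; apply/eqP/QI/subI.
  exact: (gen_ideal_gen (fun t => Gam t - (c t)%:MP)).
have [r r1 rI] := unramified Qc (fibre_inj Qc).
have Jid : is_ideal (fun g => fibre_ideal (r * g)).
  split; first by rewrite mulr0.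
    by move=> a b ha hb; rewrite mulrDr; apply: ID.
  by move=> a b hb; rewrite mulrCA; apply: IM.
have rX i : fibre_ideal (r * (tnth [tuple 'X_i | i < k.+1] i - (Q i)%:MP)).
  by rewrite tnth_mktuple; exact: rI.
have := ideal_comp_sub_eval Jid rX f.
rewrite comp_mpoly_id f0 // mpolyC0 subr0 -/(I r).
by move=> /QI/eqP; rewrite r1 oner_eq0.
Qed.

Hypothesis two_neq0 : (2%:R : K) != 0.
Variable s : 'I_k.+1 -> 'I_k.+1.
Hypothesis sK : involutive s.
Hypothesis Gam_s : forall t, permute_vars s (Gam t) = Gam t.

Definition negate_vars (f : {mpoly K[k.+1]}) := f \mPo [tuple - 'X_i | i < k.+1].

Lemma meval_negate f v : (negate_vars f).@[v] = f.@[fun i => - v i].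
Proof.
rewrite /negate_vars comp_mpoly_meval; apply: meval_eq => i.
by rewrite tnth_mktuple mevalN mevalXU.
Qed.

Lemma negate_varsM f g : negate_vars (f * g) = negate_vars f * negate_vars g.
Proof. by rewrite /negate_vars rmorphM. Qed.

Lemma negate_varsD f g : negate_vars (f + g) = negate_vars f + negate_vars g.
Proof. by rewrite /negate_vars rmorphD. Qed.

Lemma negate_homog f m : f \is m.-homog -> negate_vars f = (-1) ^+ m *: f.
Proof.
move=> fh; rewrite /negate_vars comp_mpolyEX [f in RHS]mpolyE scaler_sumr !big_seq.
apply: eq_bigr => u uf; rewrite comp_mpolyX -(dhomog_mf fh uf) scalerA [_ * f@_u]mulrC -scalerA; congr (_ *: _).
under eq_bigr do rewrite tnth_mktuple -mulN1r exprMn.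
rewrite big_split /= -mpolyXE_id prodrXr -mdegE -mul_mpolyC rmorphXn rmorphN1 //.
Qed.

Lemma negate_comp f : negate_vars (f \mPo gam) = f \mPo gam.
Proof.
rewrite [f \mPo gam]comp_mpolyEX /negate_vars raddf_sum; apply: eq_bigr => u _ /=.
rewrite linearZ /= comp_mpolyX rmorph_prod /=; congr (_ *: _); apply: eq_bigr => i _.
rewrite rmorphXn /= -/(negate_vars _) (negate_homog (autocor_tuple_homog K d lag i)).
by rewrite sqrrN expr1n scale1r.
Qed.

(** The average over the group generated by the sign change and the involution [s]. *)
Definition reynolds f : {mpoly K[k.+1]} :=
  4%:R^-1 *: (f + permute_vars s f + negate_vars (f + permute_vars s f)).

Lemma reynoldsD f g : reynolds (f + g) = reynolds f + reynolds g.
Proof. by rewrite /reynolds (raddfD (permute_vars s)) /= !negate_varsD -scalerDr; congr (_ *: _); ring. Qed.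

Lemma reynolds_sum (I : Type) (r : seq I) (F : I -> {mpoly K[k.+1]}) :
  reynolds (\sum_(i <- r) F i) = \sum_(i <- r) reynolds (F i).
Proof.
apply: (big_morph _ reynoldsD); rewrite /reynolds raddf0 /negate_vars addr0 comp_mpoly0.
by rewrite addr0 scaler0.
Qed.

Lemma reynoldsM b f : reynolds ((b \mPo gam) * f) = (b \mPo gam) * reynolds f.
Proof.
rewrite /reynolds permute_varsM permute_vars_comp; last by move=> j; rewrite tnth_mktuple.
by rewrite -mulrDr negate_varsM negate_comp -mulrDr scalerAr.
Qed.

Definition invariant f := negate_vars f = f /\ permute_vars s f = f.

Lemma four_neq0 : (4%:R : K) != 0.
Proof. by rewrite (natrM _ 2 2) mulf_neq0. Qed.

Lemma reynolds_id f : invariant f -> reynolds f = f.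
Proof.
move=> [nf sf]; rewrite /reynolds sf negate_varsD nf -mulr2n -mulr2n -mulrnA -scaler_nat scalerA.
by rewrite mulVf ?four_neq0 // scale1r.
Qed.

Lemma reynolds_mnm_invariant u : invariant (reynolds 'X_[u]).
Proof.
rewrite /reynolds; set h := 'X_[u] + _.
have hh : h \is (mdeg u).-homog.
  by apply: rpredD; rewrite ?permute_vars_homog ?dhomogX.
have sh : permute_vars s h = h by rewrite /h raddfD /= permute_varsK // addrC.
rewrite (negate_homog hh); split; last by rewrite linearZ raddfD /= linearZ /= sh.
have gh : 4%:R^-1 *: (h + (-1) ^+ mdeg u *: h) \is (mdeg u).-homog.
  by apply: rpredZ; apply: rpredD => //; apply: rpredZ.
rewrite (negate_homog gh) scalerA mulrC -scalerA scalerDr scalerA -expr2 -exprM mulnC exprM.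
by rewrite sqrrN !expr1n scale1r addrC.
Qed.

Hypothesis fibreE : forall Q : 'I_k.+1 -> K, (forall t, (Gam t).@[Q] = c t) ->
  exists e : bool, Q =1 (fun i => (-1) ^+ e * P i) \/ Q =1 (fun i => (-1) ^+ e * P (s i)).

Lemma reynolds_fibre f Q : (forall t, (Gam t).@[Q] = c t) -> (reynolds f).@[Q] = (reynolds f).@[P].
Proof.
move=> /fibreE[e QE].
have fE v (v' : 'I_k.+1 -> K) : v =1 v' -> f.@[v] = f.@[v'] by move=> vv; apply: meval_eq.
rewrite /reynolds !mevalZ !mevalD !meval_negate !mevalD !meval_permute_vars; congr (_ * _).
have E1 v : f.@[fun i => - - v i] = f.@[v] by apply: fE => i; rewrite opprK.
case: QE => QE; case: e QE => QE.
- rewrite (fE Q (fun i => - P i)) => [|i]; last by rewrite QE mulN1r.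
  rewrite (fE (fun i => Q (s i)) (fun i => - P (s i))) => [|i]; last by rewrite QE mulN1r.
  rewrite (fE (fun i => - Q i) P) => [|i]; last by rewrite QE mulN1r opprK.
  rewrite (fE (fun i => - Q (s i)) (fun i => P (s i))) => [|i]; last by rewrite QE mulN1r opprK.
  ring.
- rewrite (fE Q P) => [|i]; last by rewrite QE mul1r.
  rewrite (fE (fun i => Q (s i)) (fun i => P (s i))) => [|i]; last by rewrite QE mul1r.
  rewrite (fE (fun i => - Q i) (fun i => - P i)) => [|i]; last by rewrite QE mul1r.
  by rewrite (fE (fun i => - Q (s i)) (fun i => - P (s i))) => [|i]; rewrite ?QE ?mul1r.
- rewrite (fE Q (fun i => - P (s i))) => [|i]; last by rewrite QE mulN1r.
  rewrite (fE (fun i => Q (s i)) (fun i => - P i)) => [|i]; last by rewrite QE mulN1r sK.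
  rewrite (fE (fun i => - Q i) (fun i => P (s i))) => [|i]; last by rewrite QE mulN1r opprK.
  rewrite (fE (fun i => - Q (s i)) P) => [|i]; last by rewrite QE mulN1r opprK sK.
  ring.
- rewrite (fE Q (fun i => P (s i))) => [|i]; last by rewrite QE mul1r.
  rewrite (fE (fun i => Q (s i)) P) => [|i]; last by rewrite QE mul1r sK.
  rewrite (fE (fun i => - Q i) (fun i => - P (s i))) => [|i]; last by rewrite QE mul1r.
  rewrite (fE (fun i => - Q (s i)) (fun i => - P i)) => [|i]; last by rewrite QE mul1r sK.
  ring.
Qed.

(** The averages [F u] of finitely many monomials generate the invariants over the algebra of
    autocorrelations. By [fibre_reduced] each of them is a constant plus a combination of all of
    them with coefficients that vanish at [P]. The determinant [g] of this linear system has
    value [1] at [P] and, by Cramer's rule, takes every [F u] into the algebra. *)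
Theorem autocor_conductor : exists2 g : {mpoly K[n.+1]}, g \mPo gam != 0 &
  forall f, invariant f -> exists h, f * (g \mPo gam) = h \mPo gam.
Proof.
pose U : finType := 'X_{1..k.+1 < D}.
pose F (u : U) := reynolds 'X_[u]; pose kap u := (F u).@[P].
have step u : exists p : U -> {mpoly K[n.+1]}, (forall v, (p v \mPo gam).@[P] = 0) /\
    F u - (kap u)%:MP = \sum_v (p v \mPo gam) * F v.
  have [r rE] : fibre_ideal (F u - (kap u)%:MP).
    apply: fibre_reduced => Q Qc.
    by rewrite mevalB mevalC (reynolds_fibre _ Qc) subrr.
  have [b bE] := boolp.choice (fun t => finD (r t)).
  exists (fun v => \sum_t b t v * ('X_(idx t) - (c t)%:MP)); split=> [v|].
    rewrite (raddf_sum (comp_mpoly gam)) (raddf_sum (meval P)) big1 // => t _ /=.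
    by rewrite rmorphM mevalM rmorphB /= (comp_idx idxP) comp_mpolyC mevalB mevalC subrr mulr0.
  have inv_id : invariant (F u - (kap u)%:MP).
    have [nF sF] := reynolds_mnm_invariant (u : 'X_{1..k.+1}).
    split; first by rewrite /negate_vars raddfB /= comp_mpolyC -/(negate_vars (F u)) nF.
    by rewrite (raddfB (permute_vars s)) /= sF /permute_vars comp_mpolyC.
  rewrite -(reynolds_id inv_id) rE reynolds_sum.
  transitivity (\sum_t \sum_v ((b t v * ('X_(idx t) - (c t)%:MP)) \mPo gam) * F v).
    apply: eq_bigr => t _; rewrite {1}bE mulr_suml reynolds_sum; apply: eq_bigr => v _.
    by rewrite -reynoldsM rmorphM rmorphB /= (comp_idx idxP) comp_mpolyC mulrAC.
  rewrite exchange_big; apply: eq_bigr => v _ /=.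
  by rewrite -mulr_suml raddf_sum.
(* the linear system reads [(1 - PM) F = kap] *)
have [p pP] := boolp.choice step.
pose PM := \matrix_(i < #|U|, j < #|U|) p (enum_val i) (enum_val j).
pose N := 1%:M - PM; pose g := \det N; exists g.
  apply/eqP => g0; have : (g \mPo gam).@[P] = 1.
    rewrite /g -det_map_mx -det_map_mx.
    rewrite [X in \det X](_ : _ = 1%:M) ?det1 //.
    apply/matrixP => i j; rewrite !mxE raddfB raddfB /= (pP _).1 subr0.
    by rewrite !raddfMn /= comp_mpoly1 meval1.
  by rewrite g0 meval0 => /eqP; rewrite eq_sym oner_eq0.
have gF u : exists h, F u * (g \mPo gam) = h \mPo gam.
  exists (\sum_j \adj N (enum_rank u) j * (kap (enum_val j))%:MP).
  pose Fc : 'cV[{mpoly K[k.+1]}]_#|U| := \col_i F (enum_val i).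
  pose kc : 'cV[{mpoly K[k.+1]}]_#|U| := \col_i (kap (enum_val i))%:MP.
  have NF : map_mx (comp_mpoly gam) N *m Fc = kc.
    apply/matrixP => i j; rewrite !mxE.
    rewrite (eq_bigr (fun l => (i == l)%:R * F (enum_val l) - (p (enum_val i) (enum_val l) \mPo gam) * F (enum_val l))); last first.
      by move=> l _; rewrite !mxE raddfB /= raddfMn /= comp_mpoly1 mulrBl.
    rewrite sumrB (bigD1 i) //= eqxx mul1r big1 ?addr0; last first.
      by move=> l /negPf; rewrite eq_sym => ->; rewrite mul0r.
    have := (pP (enum_val i)).2; rewrite (reindex (@enum_val U U)) /=; last first.
      exact: onW_bij _ (Bijective (@enum_valK U) (@enum_rankK U)).
    by move=> <-; rewrite subKr.
  have /matrixP/(_ (enum_rank u) 0) : (\det (map_mx (comp_mpoly gam) N))%:M *m Fc =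
     \adj (map_mx (comp_mpoly gam) N) *m kc.
    by rewrite -mul_adj_mx -mulmxA NF.
  rewrite mul_scalar_mx !mxE det_map_mx enum_rankK mulrC => ->.
  rewrite -map_mx_adj raddf_sum; apply: eq_bigr => j _ /=.
  by rewrite [kc _ _]mxE [X in X * _]mxE rmorphM /= comp_mpolyC.
have [h hP] := boolp.choice gF.
move=> f fi; have [b bE] := finD f; exists (\sum_u b u * h u).
rewrite -(reynolds_id fi) bE reynolds_sum mulr_suml [RHS](raddf_sum (comp_mpoly gam)); apply: eq_bigr => u _ /=.
by rewrite reynoldsM [RHS](rmorphM (comp_mpoly gam)) -mulrA /= -hP.
Qed.

End Conductor.

(** * A prime trinomial *)

Section Trinomial.
Variables (K : fieldType) (p n : nat).
Hypotheses (p_gt0 : (0 < p)%N) (n_gt0 : (0 < n)%N).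

(** The outer variable is [x], the inner one is [y]. *)
Definition trinomial : {poly {poly K}} := 'X + ('X^n)%:P * (1 + 'X^p).

(** Write [A] for the trinomial, and [g = 1 + x^p] and [un] for the coefficients of [y^n] in
    [A] and in [U]. Then [D = g U - un A] has degree less than [n] in [y], and [D W] is a multiple
    of [A]. Modulo [x], [A] is [y^n] and [W] is prime to [y]; so [y^n] divides the first
    coefficient of [D] in [x], which must vanish, and inductively [D = 0]. At [y = 0] the identity
    [g U = un A] says that [g] divides [un x], whence [un] is a scalar multiple of [g]. *)
Lemma trinomial_prime (U V W : {poly {poly K}}) :
  (size U <= p.+1)%N -> (forall e, size (U`_e)%R <= n.+1)%N -> W`_0`_0 != 0 ->
  U * W = V * trinomial -> exists r : K, U = r%:P%:P * trinomial.
Proof.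
move=> sU sUe W0 UW.
pose g : {poly K} := 1 + 'X^p.
have sg : size g = p.+1 by rewrite /g addrC size_polyDl size_polyXn // size_poly1.
have g0 : g.[0] = 1 by rewrite /g !hornerE expr0n eqn0Ngt p_gt0 addr0.
have gn0 : g != 0 by rewrite -size_poly_gt0 sg.
pose un : {poly K} := \poly_(e < p.+1) U`_e`_n.
pose emb := map_poly (@polyC K).
have triE : trinomial = 'X + ('X^n)%:P * emb g.
  by rewrite /emb /g rmorphD rmorph1 /= map_polyXn.
pose D := emb g * U - emb un * trinomial.
pose V' := emb g * V - emb un * W.
have DW : D * W = V' * trinomial.
  by rewrite /D /V' !mulrBl -!mulrA UW; ring.
have tri0 : trinomial`_0 = 'X^n.
  by rewrite /trinomial coefD coefX add0r coefCM coefD coef1 coefXn (ltn_eqF p_gt0) addr0 mulr1.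
(* the coefficients of [y^n] cancel in [D] by the choice of [un] *)
have sD e : (size (D`_e)%R <= n)%N.
  apply/leq_sizeP => j; rewrite leq_eqVlt => /orP[/eqP<-|nj].
    rewrite /D coefB coefB triE mulrDr coefD coefD.
    have -> : (emb un * 'X)`_e`_n = 0.
      rewrite coefMX; case: eqP => _; first by rewrite coef0.
      by rewrite coef_map coefC eqn0Ngt n_gt0.
    rewrite add0r mulrCA coefCM coefXnM ltnn subnn -rmorphM coef_map coefC eqxx /=.
    rewrite !coefM coef_sum; apply/eqP; rewrite subr_eq0; apply/eqP.
    rewrite [RHS](reindex_inj rev_ord_inj) /=; apply: eq_bigr => i _.
    rewrite coef_map coefCM mulrC subSS subKn ?leq_ord //; congr (_ * _).
    rewrite coef_poly; case: ltnP => // h; rewrite [U`_(e - i)]nth_default ?coef0 //.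
    exact: leq_trans h.
  have UA m : (U * emb m)`_e`_j = 0.
    rewrite coefM coef_sum big1 // => i _; rewrite coef_map mulrC coefCM.
    by rewrite [_`_j]nth_default ?mulr0 // (leq_trans (sUe _)).
  rewrite /D coefB coefB mulrC UA triE sub0r mulrDr coefD coefD.
  have -> : (emb un * 'X)`_e`_j = 0.
    rewrite coefMX; case: eqP => _; first by rewrite coef0.
    by rewrite coef_map coefC; case: eqP nj => // ->.
  rewrite add0r mulrCA coefCM coefXnM ltnNge (ltnW nj) /= -rmorphM coef_map coefC.
  by rewrite subn_eq0 leqNgt nj oppr0.
have DV e : D`_e = 0 /\ V'`_e = 0.
  elim/ltn_ind: e => e low.
  have /(congr1 (coefp e)) := DW; rewrite /= !coefM.
  rewrite big_ord_recr /= subnn big1 => [|i _]; last by rewrite (low _ _).1 ?mul0r.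
  rewrite [in RHS]big_ord_recr /= subnn big1 => [|i _]; last by rewrite (low _ _).2 ?mul0r.
  rewrite !add0r tri0 => E.
  have De : D`_e = 0.
    have cop : coprimep 'X^n W`_0.
      rewrite coprimep_expl // coprimep_sym -[X in coprimep _ X]subr0.
      by rewrite coprimep_XsubC rootE horner_coef0.
    apply/eqP; apply: contraLR (dvdp_mull V'`_e (dvdpp 'X^n)) => Dn0.
    by rewrite -E Gauss_dvdpl // gtNdvdp // size_polyXn ltnS; exact: sD.
  split=> //; move/esym/eqP: E; rewrite De mul0r mulf_eq0 expf_eq0 polyX_eq0 andbF orbF.
  by move/eqP.
have gU : emb g * U = emb un * trinomial.
  apply/eqP; rewrite -subr_eq0; apply/eqP/polyP => e; rewrite coef0; exact: (DV e).1.
(* setting [y = 0] turns [emb] into the identity and the trinomial into [x] *)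
pose ev0 := map_poly (horner_eval (0 : K)).
have ev0emb m : ev0 (emb m) = m.
  apply/polyP => i; rewrite !coef_map /= /horner_eval hornerC //.
have ev0M a b : ev0 (a * b) = ev0 a * ev0 b by exact: rmorphM.
have evtri : ev0 trinomial = 'X.
  rewrite /ev0 /trinomial rmorphD.
  rewrite rmorphM /= map_polyX map_polyC /= /horner_eval hornerXn.
  by rewrite expr0n eqn0Ngt n_gt0 polyC0 mul0r addr0.
have : g * ev0 U = un * 'X.
  by have /(congr1 ev0) := gU; rewrite !ev0M !ev0emb evtri.
move=> gun; have : g %| un * 'X by rewrite -gun dvdp_mulr.
rewrite Gauss_dvdpl; last by rewrite -[X in coprimep _ X]subr0 coprimep_XsubC rootE g0 oner_eq0.
case/dvdpP => r unE.
have : (size r <= 1)%N.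
  have [->|r0] := eqVneq r 0; first by rewrite size_poly0.
  have : (size un <= p.+1)%N by apply: size_poly.
  by rewrite unE size_mul // sg addnS /= -[p.+1]add1n leq_add2r.
move/size1_polyC => rE; exists r`_0.
have egn0 : emb g != 0 by rewrite map_poly_eq0.
have -> : (r`_0)%:P%:P = emb r by rewrite [in RHS]rE /emb map_polyC.
have embM a b : emb (a * b) = emb a * emb b by exact: rmorphM.
by apply: (mulfI egn0); rewrite gU unE embM; ring.
Qed.

End Trinomial.

(** * The fibre through the special point *)

Section SpecialPoint.
Variables (K : fieldType) (p n k : nat).
Hypotheses (p_gt0 : (0 < p)%N) (n_gt0 : (0 < n)%N) (kE : k.+1 = (p.+1 * n.+1)%N).
Local Notation I := 'I_k.+1.

(** An index [i] below [(p + 1) (n + 1)] stands for the exponents of [x^(xdeg i) y^(ydeg i)]. *)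
Definition xdeg (i : I) := (i %% p.+1)%N.
Definition ydeg (i : I) := (i %/ p.+1)%N.

Lemma xdeg_le i : (xdeg i <= p)%N. Proof. by rewrite -ltnS ltn_mod. Qed.
Lemma ydeg_le i : (ydeg i <= n)%N.
Proof. by rewrite -ltnS /ydeg ltn_divLR // mulnC -kE ltn_ord. Qed.
Lemma indexE (i : I) : (i = ydeg i * p.+1 + xdeg i :> nat)%N. Proof. exact: divn_eq. Qed.
Lemma index_inj i j : xdeg i = xdeg j -> ydeg i = ydeg j -> i = j.
Proof. by move=> ex ey; apply: val_inj; rewrite /= indexE (indexE j) ex ey. Qed.

Lemma index_rev i : xdeg (rev_ord i) = (p - xdeg i)%N /\ ydeg (rev_ord i) = (n - ydeg i)%N.
Proof.
have := xdeg_le i; have := ydeg_le i => hy hx.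
have e : rev_ord i = ((n - ydeg i) * p.+1 + (p - xdeg i))%N :> nat.
  rewrite /= subSS {1}(indexE i).
  have kE' : k = (n * p.+1 + p)%N by apply: succn_inj; rewrite kE; lia.
  rewrite kE' mulnBl.
  have : (ydeg i * p.+1 <= n * p.+1)%N by rewrite leq_mul2r hy orbT.
  lia.
have lt : (p - xdeg i < p.+1)%N by rewrite ltnS leq_subr.
by rewrite {1}/xdeg {1}/ydeg e modnMDl modn_small // divnMDl // divn_small // addn0.
Qed.

Definition monomial2 (a b : nat) : {poly {poly K}} := ('X^b)%:P * 'X^a.

Definition genpoly (b : I -> K) : {poly {poly K}} :=
  \sum_i (b i)%:P%:P * monomial2 (xdeg i) (ydeg i).

Lemma coef_monomial2 a b e v : (monomial2 a b)`_e`_v = ((e == a) && (v == b))%:R :> K.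
Proof.
rewrite /monomial2 coefCM coefXn; case: eqP => _; last by rewrite mulr0 coef0.
by rewrite mulr1 coefXn.
Qed.

Lemma coef_genpoly b e v : (genpoly b)`_e`_v = \sum_i b i * ((e == xdeg i) && (v == ydeg i))%:R.
Proof.
rewrite /genpoly coef_sum coef_sum; apply: eq_bigr => i _.
by rewrite coefCM coefCM coef_monomial2.
Qed.

Lemma coef_genpoly_index b i : (genpoly b)`_(xdeg i)`_(ydeg i) = b i.
Proof.
rewrite coef_genpoly (bigD1 i) //= !eqxx mulr1 big1 ?addr0 // => j ji.
case: andP => [[/eqP ex /eqP ey]|]; last by rewrite mulr0.
by rewrite (index_inj ex ey) eqxx in ji.
Qed.

Lemma genpoly_inj a b : genpoly a = genpoly b -> a =1 b.
Proof. by move=> ab i; rewrite -coef_genpoly_index ab coef_genpoly_index. Qed.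

Lemma size_genpoly b : (size (genpoly b) <= p.+1)%N.
Proof.
apply/leq_sizeP => e pe; apply/polyP => v; rewrite coef_genpoly coef0 big1 // => i _.
case: eqP => [ei|]; last by rewrite mulr0.
by have := xdeg_le i; rewrite -ei leqNgt pe.
Qed.

Lemma size_genpoly_coef b e : (size ((genpoly b)`_e)%R <= n.+1)%N.
Proof.
apply/leq_sizeP => v nv; rewrite coef_genpoly big1 // => i _.
case: (v =P _) => [vi|]; last by rewrite andbF mulr0.
by have := ydeg_le i; rewrite -vi leqNgt nv.
Qed.

Lemma genpoly_scale r b : genpoly (fun i => r * b i) = r%:P%:P * genpoly b.
Proof. by rewrite /genpoly mulr_sumr; apply: eq_bigr => i _; rewrite !polyCM mulrA. Qed.

Lemma eq_genpoly a b : a =1 b -> genpoly a = genpoly b.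
Proof. by move=> ab; apply: eq_bigr => i _; rewrite ab. Qed.

Definition rev_fun (b : I -> K) i := b (rev_ord i).

Lemma genpoly_mul_rev a b : genpoly a * genpoly (rev_fun b) =
  \sum_i \sum_j (a i * b j)%:P%:P * monomial2 (xdeg i + (p - xdeg j)) (ydeg i + (n - ydeg j)).
Proof.
rewrite /genpoly mulr_suml; apply: eq_bigr => i _.
rewrite [X in _ * X](reindex_inj rev_ord_inj) mulr_sumr; apply: eq_bigr => j _ /=.
rewrite /rev_fun rev_ordK (index_rev j).1 (index_rev j).2 /monomial2.
by rewrite !polyCM !exprD polyCM; ring.
Qed.

Variables (L : finType) (d : I -> I -> L).
Hypothesis dx : forall i j i' j', d i j = d i' j' -> (xdeg j + xdeg i' = xdeg j' + xdeg i)%N.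
Hypothesis dy : forall i j i' j', d i j = d i' j' -> (ydeg j + ydeg i' = ydeg j' + ydeg i)%N.

(** The exponents on the left depend on [i] and [j] only through the lag [d i j]. *)
Lemma group_by_lag (c : I -> I -> K) : (forall t, \sum_i \sum_(j | d i j == t) c i j = 0) ->
  \sum_i \sum_j (c i j)%:P%:P * monomial2 (xdeg i + (p - xdeg j)) (ydeg i + (n - ydeg j)) = 0.
Proof.
move=> c0; rewrite pair_big /=.
rewrite (partition_big (fun ij : I * I => d ij.1 ij.2) xpredT) //= big1 // => t _.
have [/existsP[[i0 j0] /eqP d0]|/existsPn h] := boolP [exists ij : I * I, d ij.1 ij.2 == t]; last first.
  by rewrite big_pred0 // => ij; apply/negbTE/h.
transitivity ((\sum_(ij : I * I | d ij.1 ij.2 == t) c ij.1 ij.2)%:P%:P *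
   monomial2 (xdeg i0 + (p - xdeg j0)) (ydeg i0 + (n - ydeg j0))).
  rewrite !rmorph_sum mulr_suml; apply: eq_bigr => -[i j] /= /eqP dij.
  have := dx (etrans d0 (esym dij)); have := dy (etrans d0 (esym dij)).
  have := xdeg_le j; have := xdeg_le j0; have := ydeg_le j; have := ydeg_le j0 => /= h1 h2 h3 h4 h5 h6.
  by congr (_ * monomial2 _ _); lia.
rewrite -(pair_big_dep xpredT (fun i j => d i j == t)) c0.
by rewrite !polyC0 mul0r.
Qed.

Definition corner_x : I := inord 1.
Definition corner_y : I := inord (n * p.+1).

(** The indices [1], [n (p + 1)] and [n (p + 1) + p] of [x], [y^n] and [x^p y^n]. *)
Definition special_point (i : I) : K := (i == corner_x)%:R + (i == corner_y)%:R + (i == ord_max)%:R.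

Local Notation P := special_point.
Local Notation A := (trinomial K p n).

Lemma k_eq : k = (n * p.+1 + p)%N.
Proof. by apply: succn_inj; rewrite kE; lia. Qed.

Lemma val_corner_x : corner_x = 1%N :> nat.
Proof. by rewrite /corner_x inordK // k_eq; nia. Qed.
Lemma val_corner_y : corner_y = (n * p.+1)%N :> nat.
Proof. by rewrite /corner_y inordK // k_eq; lia. Qed.

Lemma genpoly_special : genpoly P = A.
Proof.
have delta (i0 : I) : genpoly (fun i => (i == i0)%:R) = monomial2 (xdeg i0) (ydeg i0).
  rewrite /genpoly (bigD1 i0) //= eqxx !polyC1 mul1r big1 ?addr0 // => i /negPf ->.
  by rewrite !polyC0 mul0r.
transitivity (genpoly (fun i => (i == corner_x)%:R) + genpoly (fun i => (i == corner_y)%:R) + genpoly (fun i => (i == ord_max)%:R)).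
  by rewrite /genpoly -!big_split; apply: eq_bigr => i _; rewrite /special_point !polyCD !mulrDl.
rewrite !delta /xdeg /ydeg val_corner_x val_corner_y /= {1 2}k_eq modnMl mulnK // modnMDl divnMDl //.
rewrite !modn_small ?divn_small // addn0 /monomial2 /trinomial expr0 expr1 polyC1 mul1r mulr1.
by rewrite mulrDr mulr1 addrA.
Qed.

Lemma coef00_rev_special : (genpoly (rev_fun P))`_0`_0 = 1.
Proof.
have -> : (genpoly (rev_fun P))`_0`_0 = rev_fun P ord0.
  by rewrite -[RHS]coef_genpoly_index /xdeg /ydeg mod0n div0n.
rewrite /rev_fun /special_point.
have -> : rev_ord (ord0 : I) = ord_max by apply: val_inj; rewrite /= subn1.
rewrite eqxx -!val_eqE /= val_corner_x val_corner_y k_eq.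
rewrite gtn_eqF ?add0r; last by nia.
by rewrite gtn_eqF ?add0r //; lia.
Qed.

Lemma trinomial_neq0 : A != 0.
Proof.
apply/eqP => A0; have := coef_genpoly_index P corner_x; rewrite genpoly_special A0 !coef0 /special_point eqxx.
rewrite -!val_eqE /= val_corner_x val_corner_y k_eq.
rewrite ltn_eqF; last by nia.
rewrite ltn_eqF; last by nia.
by rewrite !addr0 => /eqP; rewrite eq_sym oner_eq0.
Qed.

Lemma genpoly_rev_neq0 : genpoly (rev_fun P) != 0.
Proof. by apply/eqP => h; move: coef00_rev_special; rewrite h !coef0 => /eqP; rewrite eq_sym oner_eq0. Qed.

Lemma genpoly_eq_scale b r : genpoly b = r%:P%:P * A -> b =1 (fun i => r * P i).
Proof. by move=> h; apply: genpoly_inj; rewrite genpoly_scale genpoly_special. Qed.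

Lemma sqr1_sign (r : K) : r ^+ 2 = 1 -> exists e : bool, r = (-1) ^+ e.
Proof.
move=> /eqP; rewrite sqrf_eq1 => /orP[/eqP->|/eqP->]; first by exists false.
by exists true.
Qed.

Lemma polyCC_eq1 (r : K) (F : {poly {poly K}}) : F != 0 -> (r ^+ 2)%:P%:P * F = F -> r ^+ 2 = 1.
Proof.
move=> F0; rewrite -{2}[F]mul1r => /(mulIf F0) /(congr1 (fun f : {poly {poly K}} => f`_0`_0)).
by rewrite coefC /= coefC /= coef1 /= coef1.
Qed.

Lemma coef_trinomial0 e : A`_e`_0 = (e == 1%N)%:R.
Proof.
rewrite /trinomial coefD coefX coefD coefCM coefXnM n_gt0 addr0.
by case: eqP => _; rewrite ?coef1 ?coef0.
Qed.

Lemma coef1M (f g : {poly {poly K}}) :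
  (f * g)`_1`_0 = f`_0`_0 * g`_1`_0 + f`_1`_0 * g`_0`_0.
Proof. by rewrite coefM big_ord_recr big_ord1 /= coefD !coef0M. Qed.

(** The generating polynomials satisfy [B * B_rev = A * A_rev]. The coefficient of [x] at [y = 0]
    of the right side is nonzero, so [B] and [B_rev] cannot both vanish at the origin. If one
    of them does not, [trinomial_prime] makes the other a multiple of [A], by a factor of square
    one. *)
Lemma special_fibre (Q : I -> K) :
  (forall t, \sum_i \sum_(j | d i j == t) Q i * Q j = \sum_i \sum_(j | d i j == t) P i * P j) ->
  exists e : bool, Q =1 (fun i => (-1) ^+ e * P i) \/ Q =1 (fun i => (-1) ^+ e * P (rev_ord i)).
Proof.
move=> QP.
have prod : genpoly Q * genpoly (rev_fun Q) = A * genpoly (rev_fun P).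
  apply/eqP; rewrite -genpoly_special -subr_eq0 !genpoly_mul_rev -sumrB.
  under eq_bigr do rewrite -sumrB.
  apply/eqP; transitivity (\sum_i \sum_j (Q i * Q j - P i * P j)%:P%:P *
      monomial2 (xdeg i + (p - xdeg j)) (ydeg i + (n - ydeg j))).
    by apply: eq_bigr => i _; apply: eq_bigr => j _; rewrite !polyCB mulrBl.
  apply: group_by_lag => t; apply/eqP.
  rewrite (eq_bigr (fun i => \sum_(j | d i j == t) Q i * Q j - \sum_(j | d i j == t) P i * P j)) => [|i _]; last by rewrite sumrB.
  by rewrite sumrB QP subrr.
have [W0|W0] := eqVneq (genpoly (rev_fun Q))`_0`_0 0.
  have V0 : (genpoly Q)`_0`_0 != 0.
    apply/eqP => V0; have /eqP := congr1 (fun f : {poly {poly K}} => f`_1`_0) prod.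
    rewrite !coef1M W0 V0 mul0r mulr0 addr0 !coef_trinomial0 coef00_rev_special mul0r.
    by rewrite mulr1 add0r eq_sym oner_eq0.
  have [r rE] := trinomial_prime p_gt0 n_gt0 (size_genpoly (rev_fun Q)) (size_genpoly_coef (rev_fun Q)) V0
     (etrans (mulrC _ _) (etrans prod (mulrC _ _))).
  have QE : Q =1 (fun i => r * P (rev_ord i)).
    by move=> i; rewrite -(genpoly_eq_scale rE) /rev_fun rev_ordK.
  have r2 : r ^+ 2 = 1.
    apply: (polyCC_eq1 (mulf_neq0 trinomial_neq0 genpoly_rev_neq0)).
    rewrite -[RHS]prod rE (eq_genpoly QE) genpoly_scale -/(rev_fun P) expr2 !polyCM; ring.
  have [e re] := sqr1_sign r2; exists e; right => i; by rewrite QE re.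
have [r rE] := trinomial_prime p_gt0 n_gt0 (size_genpoly Q) (size_genpoly_coef Q) W0
   (etrans prod (mulrC _ _)).
have QE := genpoly_eq_scale rE.
have r2 : r ^+ 2 = 1.
  apply: (polyCC_eq1 (mulf_neq0 trinomial_neq0 genpoly_rev_neq0)).
  have QrE : rev_fun Q =1 (fun i => r * rev_fun P i) by move=> i; rewrite /rev_fun QE.
  rewrite -[RHS]prod rE (eq_genpoly QrE) genpoly_scale expr2 !polyCM; ring.
have [e re] := sqr1_sign r2; exists e; left => i; by rewrite QE re.
Qed.

Lemma tangent_prod (Q b : I -> K) :
  (forall t, \sum_i \sum_(j | d i j == t) (Q i * b j + b i * Q j) = 0) ->
  genpoly Q * genpoly (rev_fun b) + genpoly b * genpoly (rev_fun Q) = 0.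
Proof.
move=> h; rewrite !genpoly_mul_rev -big_split -[RHS](group_by_lag h).
apply: eq_bigr => i _; rewrite -big_split; apply: eq_bigr => j _ /=.
by rewrite -mulrDl -!polyCD.
Qed.

Hypothesis two_neq0 : (2%:R : K) != 0.

Lemma double_neq0 (F G : {poly {poly K}}) r : F != 0 -> G != 0 ->
  r%:P%:P * F * G + r%:P%:P * F * G = 0 -> r = 0.
Proof.
move=> F0 G0; rewrite -mulr2n -mulrnAl -mulrnAl -!polyCMn => /eqP.
rewrite !mulf_eq0 (negPf F0) (negPf G0) !orbF !polyC_eq0 -mulr_natl mulf_eq0 (negPf two_neq0) /=.
by move/eqP.
Qed.

(** A tangent vector [b] gives [A * b_rev = - b * A_rev]; by [trinomial_prime], [b] is a multiple
    of [A], hence [b_rev] the same multiple of [A_rev], and the equation becomes [2 r A A_rev = 0]. *)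
Lemma special_unramified (Q b : I -> K) :
  (exists e : bool, Q =1 (fun i => (-1) ^+ e * P i) \/ Q =1 (fun i => (-1) ^+ e * P (rev_ord i))) ->
  (forall t, \sum_i \sum_(j | d i j == t) (Q i * b j + b i * Q j) = 0) ->
  forall i, b i = 0.
Proof.
move=> [e QE] /tangent_prod h.
have sgn0 : ((-1) ^+ e)%:P%:P != 0 :> {poly {poly K}} by rewrite !polyC_eq0 signr_eq0.
have r00 : (genpoly (rev_fun P))`_0`_0 != 0 by rewrite coef00_rev_special oner_eq0.
have Ar0 := genpoly_rev_neq0; have A0 := trinomial_neq0.
case: QE => QE.
  have QrE : rev_fun Q =1 (fun i => (-1) ^+ e * rev_fun P i) by move=> i; rewrite /rev_fun QE.
  have {}h : A * genpoly (rev_fun b) + genpoly b * genpoly (rev_fun P) = 0.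
    apply: (mulfI sgn0); rewrite mulr0 -h (eq_genpoly QE) (eq_genpoly QrE) !genpoly_scale genpoly_special; ring.
  have hU : genpoly b * genpoly (rev_fun P) = (- genpoly (rev_fun b)) * A.
    by apply/eqP; rewrite -subr_eq0; apply/eqP; rewrite -h; ring.
  have [r rE] := trinomial_prime p_gt0 n_gt0 (size_genpoly b) (size_genpoly_coef b) r00 hU.
  have bE := genpoly_eq_scale rE.
  have brE : rev_fun b =1 (fun i => r * rev_fun P i) by move=> i; rewrite /rev_fun bE.
  have r0 : r = 0.
    apply: (double_neq0 A0 Ar0); rewrite -h rE (eq_genpoly brE) genpoly_scale; ring.
  by move=> i; rewrite bE r0 mul0r.
have QrE : rev_fun Q =1 (fun i => (-1) ^+ e * P i) by move=> i; rewrite /rev_fun QE rev_ordK.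
have {}h : genpoly (rev_fun P) * genpoly (rev_fun b) + genpoly b * A = 0.
  apply: (mulfI sgn0); rewrite mulr0 -h (eq_genpoly QE) (eq_genpoly QrE) !genpoly_scale genpoly_special -/(rev_fun P); ring.
have hU : genpoly (rev_fun b) * genpoly (rev_fun P) = (- genpoly b) * A.
  by apply/eqP; rewrite -subr_eq0; apply/eqP; rewrite -h; ring.
have [r rE] := trinomial_prime p_gt0 n_gt0 (size_genpoly (rev_fun b)) (size_genpoly_coef (rev_fun b)) r00 hU.
have brE := genpoly_eq_scale rE.
have bE : b =1 (fun i => r * rev_fun P i).
  by move=> i; rewrite /rev_fun -brE /rev_fun rev_ordK.
have r0 : r = 0.
  apply: (double_neq0 A0 Ar0); rewrite -h rE (eq_genpoly bE) genpoly_scale; ring.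
by move=> i; rewrite bE r0 mul0r.
Qed.

End SpecialPoint.

(** * Mixed radix expansions and Kronecker substitution *)

Definition radix (q k : nat -> nat) m := (\sum_(0 <= i < m) k i * \prod_(0 <= j < i) (q j).+1)%N.

Lemma radix_lt q k m : (forall i, (i < m)%N -> (k i <= q i)%N) ->
  (radix q k m < \prod_(0 <= j < m) (q j).+1)%N.
Proof.
rewrite /radix; elim: m => [|m IH] kq; first by rewrite !big_nil.
rewrite !big_nat_recr //=; have := IH (fun i im => kq i (ltnW im)).
have := kq m (ltnSn m); move: (\sum_(_ <= _ < _) _)%N (\prod_(_ <= _ < _) _)%N => a b; nia.
Qed.

Lemma radix_inj q k k' m : (forall i, (i < m)%N -> (k i <= q i)%N) ->
  (forall i, (i < m)%N -> (k' i <= q i)%N) -> radix q k m = radix q k' m ->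
  forall i, (i < m)%N -> k i = k' i.
Proof.
elim: m => // m IH kq kq' e i.
have ltm := radix_lt (fun i im => kq i (leqW im)).
have ltm' := radix_lt (fun i im => kq' i (leqW im)).
move: e; rewrite /radix !big_nat_recr //= -/(radix q k m) -/(radix q k' m).
move: ltm ltm'; set B := (\prod_(_ <= _ < _) _)%N => ltm ltm' e.
have B0 : (0 < B)%N by apply: leq_ltn_trans ltm.
have km : k m = k' m.
  have := congr1 (fun x => x %/ B)%N e.
  by rewrite !(addnC (radix _ _ _)) !divnMDl // !divn_small // !addn0.
have er : radix q k m = radix q k' m by move: e; rewrite km => /addIn.
rewrite ltnS leq_eqVlt => /orP[/eqP->//|im].
exact: (IH (fun i im => kq i (leqW im)) (fun i im => kq' i (leqW im)) er).
Qed.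

(** Kronecker substitution: on the curve with coordinates [x ^+ (D.+1 ^ i)] distinct monomials
    become distinct powers of [x], so [p] restricts to a nonzero polynomial in one variable. *)
Lemma mpoly_eval_eq0 (K : numFieldType) n (p : {mpoly K[n]}) :
  (forall v, p.@[v] = 0) -> p = 0.
Proof.
move=> p0; apply: contrapT => /eqP pn0.
pose D := msize p; pose wt (u : 'X_{1..n}) := radix (fun=> D) (fun i => nth 0%N u i) n.
pose P : {poly K} := \sum_(u <- msupp p) p@_u *: 'X^(wt u).
have wt_inj : {in msupp p &, injective wt}.
  have bnd (u : 'X_{1..n}) : u \in msupp p -> forall l, (l < n)%N -> (nth 0%N u l <= D)%N.
    move=> up l lti; have := msize_mdeg_lt up; rewrite -/D mdegE => ltD.
    rewrite -[l]/(nat_of_ord (Ordinal lti)) -mnm_nth; apply: ltnW; apply: leq_ltn_trans ltD.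
    by rewrite (bigD1 (Ordinal lti)) //= leq_addr.
  move=> u u' uP u'P e; apply/mnmP => i; rewrite !(mnm_nth 0%N).
  exact: (radix_inj (bnd _ uP) (bnd _ u'P) e).
have Pn0 : P != 0.
  pose u0 := mlead p; have u0P := mlead_supp pn0.
  apply: contraNneq pn0 => /(congr1 (coefp (wt u0))) /=.
  rewrite coef0 coef_sum (bigD1_seq u0) ?msupp_uniq //= coefZ coefXn eqxx mulr1 big_seq_cond big1.
    by rewrite addr0 => /eqP; rewrite mleadc_eq0.
  move=> u /andP[uP uu0]; rewrite coefZ coefXn; case: eqP => [e|]; last by rewrite mulr0.
  by move: uu0; rewrite -(wt_inj _ _ u0P uP e) eqxx.
have Peval x : P.[x] = p.@[fun i => x ^+ (\prod_(0 <= j < i) D.+1)].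
  rewrite horner_sum mevalE; apply: eq_bigr => u _; rewrite hornerZ hornerXn; congr (_ * _).
  under eq_bigr do rewrite -exprM.
  rewrite -expr_sum /wt /radix big_mkord; congr (_ ^+ _); apply: eq_bigr => i _.
  by rewrite (mnm_nth 0%N) mulnC.
have : (size [seq i%:R : K | i <- iota 0 (size P)] < size P)%N.
  apply: max_poly_roots => //; last first.
    by rewrite map_inj_uniq ?iota_uniq // => i j /eqP; rewrite eqr_nat => /eqP.
  by apply/allP => x _; rewrite rootE Peval p0.
by rewrite size_map size_iota ltnn.
Qed.

(** * The variety of autocorrelations *)

Section AutocorVariety.
Variables (K : numFieldType) (k : nat) (L : finType) (d : 'I_k.+1 -> 'I_k.+1 -> L).
Hypothesis dw : forall i j i' j', d i j = d i' j' -> (j + i' = j' + i)%N.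
Variables (n : nat) (lag : 'I_n.+1 -> L) (idx : L -> 'I_n.+1).
Local Notation Gam := (autocor K d).
Hypothesis idxP : forall t, Gam (lag (idx t)) = Gam t.
Local Notation gam := (autocor_tuple K d lag).

Definition autocor_vec (v : 'I_k.+1 -> K) : 'rV[K]_n.+1 := \row_j (Gam (lag j)).@[v].

Variable X : set (proj K n).
Hypothesis XP : forall y, X y <-> exists v, (exists i, v i != 0) /\ line y = <[autocor_vec v]>%VS.

(** A power of ['X_i * 'X_i] lies in the ideal of the autocorrelations. *)
Lemma autocor_vec_neq0 v i : v i != 0 -> autocor_vec v != 0.
Proof.
move=> vi; apply: contraNneq vi => g0.
have G0 t : (Gam t).@[v] = 0.
  by have /rowP/(_ (idx t)) := g0; rewrite !mxE idxP.
have [N [r rE]] : gen_radical Gam ('X_i * 'X_i) by exact: (autocor_radical K (@ord_inj _) dw i i).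
have := congr1 (meval v) rE; rewrite rmorphXn rmorphM /= mevalXU raddf_sum big1 => [|t _] /=.
  by move=> /eqP; rewrite expf_eq0 mulf_eq0 orbb => /andP[].
by rewrite mevalM G0 mulr0.
Qed.

Lemma point_of v i : v i != 0 -> exists2 y, X y & line y = <[autocor_vec v]>%VS.
Proof.
move=> vi; have dl : \dim <[autocor_vec v]> == 1%N by rewrite dim_vline (autocor_vec_neq0 vi).
by exists (Proj dl) => //; apply/XP; exists v; split=> //; exists i.
Qed.

Lemma meval_comp_gam f v : (f \mPo gam).@[v] = f.@[fun i => autocor_vec v 0 i].
Proof. by rewrite comp_mpoly_meval; apply: meval_eq => j; rewrite tnth_mktuple mxE. Qed.

Lemma vanishes_at_point f e y v : f \is e.-homog -> line y = <[autocor_vec v]>%VS ->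
  vanishes_at f y <-> (f \mPo gam).@[v] = 0.
Proof. by move=> fh yE; rewrite meval_comp_gam; exact: (vanishes_atE fh yE). Qed.

(** Multiply [p] by ['X_ord0] to get a polynomial that vanishes everywhere. *)
Lemma eq0_of_nonzero (p : {mpoly K[k.+1]}) :
  (forall v, v ord0 != 0 -> p.@[v] = 0) -> p = 0.
Proof.
move=> p0; have : p * 'X_ord0 = 0.
  apply: mpoly_eval_eq0 => v; rewrite mevalM mevalXU.
  by have [->|/p0->] := eqVneq (v ord0) 0; rewrite ?mulr0 ?mul0r.
move/eqP; rewrite mulf_eq0 => /orP[/eqP//|/eqP/(congr1 (mcoeff U_(ord0)))/eqP].
by rewrite mcoeffXU eqxx mcoeff0 oner_eq0.
Qed.

Lemma vanishing_comp f e : f \is e.-homog -> vanishing X f <-> f \mPo gam = 0.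
Proof.
move=> fh; split=> [fX|f0 y /XP[v [_ yE]]]; last first.
  by apply/(vanishes_at_point fh yE); rewrite f0 meval0.
apply: eq0_of_nonzero => v v0; have [y Xy yE] := point_of v0.
exact/(vanishes_at_point fh yE)/fX.
Qed.

Definition initial i (v : 'I_k.+1 -> K) := forall j : 'I_k.+1, (i < j)%N -> v j = 0.

(** The closure in [X] of the image of the vectors supported on the indices up to [i]. *)
Definition stratum i : set (proj K n) := [set y | X y /\
  forall f e, f \is e.-homog -> (forall v, initial i v -> (f \mPo gam).@[v] = 0) -> vanishes_at f y]%classic.

Lemma stratum_closed i : closed_in X (stratum i).
Proof.
pose S : set {mpoly K[n.+1]} := [set f | (exists e, f \is e.-homog) /\
  forall v, initial i v -> (f \mPo gam).@[v] = 0]%classic.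
exists [set y | forall f, S f -> vanishes_at f y]%classic.
  by exists S => // f [].
rewrite predeqE => y; split=> [[Xy h]|[h Xy]]; split=> //.
  by move=> f [[e fh] f0]; apply: h fh f0.
by move=> f e fh f0; apply: h; split=> //; exists e.
Qed.

Lemma stratum_point i v : initial i v -> v ord0 != 0 ->
  exists2 y, stratum i y & line y = <[autocor_vec v]>%VS.
Proof.
move=> iv v0; have [y Xy yE] := point_of v0; exists y => //; split=> // f e fh f0.
by apply/(vanishes_at_point fh yE)/f0.
Qed.

Definition truncate i (v : 'I_k.+1 -> K) (j : 'I_k.+1) := if (j <= i)%N then v j else 0.

Lemma truncate_initial i v : initial i (truncate i v).
Proof. by move=> j ij; rewrite /truncate leqNgt ij. Qed.

(** The polynomial functions on a linear space form an integral domain. *)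
Lemma initial_prime i (f g : {mpoly K[k.+1]}) :
  (forall v, initial i v -> v ord0 != 0 -> f.@[v] * g.@[v] = 0) ->
  (forall v, initial i v -> f.@[v] = 0) \/ (forall v, initial i v -> g.@[v] = 0).
Proof.
move=> fg0.
pose T := [tuple if (j <= i)%N then 'X_j else 0 : {mpoly K[k.+1]} | j < k.+1].
have evT (h : {mpoly K[k.+1]}) v : (h \mPo T).@[v] = h.@[truncate i v].
  rewrite comp_mpoly_meval; apply: meval_eq => j; rewrite tnth_mktuple /truncate.
  by case: ifP => _; rewrite ?mevalXU ?meval0.
have : (f \mPo T) * (g \mPo T) = 0.
  apply: eq0_of_nonzero => v v0; rewrite mevalM !evT; apply: fg0 => //.
  exact: truncate_initial.
have trid h v : initial i v -> h \mPo T = 0 -> h.@[v] = 0.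
  move=> iv h0; have := evT h v; rewrite h0 meval0 => ->; apply: meval_eq => j.
  by rewrite /truncate; case: leqP => // /iv ->.
by move/eqP; rewrite mulf_eq0 => /orP[/eqP h|/eqP h]; [left|right] => v iv; apply: trid h.
Qed.

(** Two forms that do not vanish on the stratum have a product that does not, because the
    vectors in question form a linear space. *)
Lemma stratum_irreducible i : irreducible (stratum i).
Proof.
split.
  have [||y Zy _] := @stratum_point i (fun j => (j == ord0)%:R); last by exists y.
    by move=> j ij; case: eqP ij => // ->.
  by rewrite eqxx oner_eq0.
move=> Z1 Z2 [A1 [S1 S1h A1E] Z1E] [A2 [S2 S2h A2E] Z2E] ZE.
apply: contrapT => /not_orP[n1 n2].
have sub Z' A' : Z' = (A' `&` stratum i)%classic -> Z' <> stratum i -> exists2 y, stratum i y & ~ A' y.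
  move=> -> ne; apply: contrapT => h; apply: ne; rewrite predeqE => y; split=> [[]//|Zy]; split=> //.
  by apply: contrapT => nA; apply: h; exists y.
have [y1 Zy1 ny1] := sub _ _ Z1E n1; have [y2 Zy2 ny2] := sub _ _ Z2E n2.
move: ny1 ny2; rewrite A1E A2E /= => /existsNP[f1 /not_implyP[Sf1 nf1]] /existsNP[f2 /not_implyP[Sf2 nf2]].
have [e1 f1h] := S1h _ Sf1; have [e2 f2h] := S2h _ Sf2.
have [] := @initial_prime i (f1 \mPo gam) (f2 \mPo gam).
- move=> v iv v0; have [y Zy yE] := stratum_point iv v0.
  move: (Zy); rewrite ZE Z1E Z2E A1E A2E => -[[h _]|[h _]].
    by rewrite (iffLR (vanishes_at_point f1h yE) (h _ Sf1)) mul0r.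
  by rewrite (iffLR (vanishes_at_point f2h yE) (h _ Sf2)) mulr0.
- by move=> h; apply: nf1; apply: Zy1.2 f1h h.
- by move=> h; apply: nf2; apply: Zy2.2 f2h h.
Qed.

(** The coordinate at the lag from index [0] to [i.+1] vanishes on [stratum i], as this lag is
    not the difference of two indices up to [i]. *)
Lemma stratum_lt i : (i < k)%N -> (stratum i `<` stratum i.+1)%classic.
Proof.
move=> ik; split.
  move=> y [Xy h]; split=> // f e fh f0; apply: h fh _ => v iv; apply: f0 => j ij.
  by apply: iv; apply: ltnW.
(* the autocorrelation at this lag takes the value one at the sum of two basis vectors *)
pose j1 : 'I_k.+1 := Ordinal (ik : (i.+1 < k.+1)%N).
pose v (j : 'I_k.+1) : K := (j == ord0)%:R + (j == j1)%:R.
have j10 : (ord0 == j1) = false by [].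
have v0 : v ord0 = 1 by rewrite /v eqxx j10 addr0.
have [||y Zy yE] := @stratum_point i.+1 v _ _.
- move=> j ij; rewrite /v -!val_eqE /= (gtn_eqF (leq_ltn_trans _ ij)) // gtn_eqF //.
  by rewrite addr0.
- by rewrite v0 oner_eq0.
move=> /(_ y Zy)[_ h].
have Xh : ('X_(idx (d ord0 j1)) : {mpoly K[n.+1]}) \is 1.-homog by rewrite dhomogX /= mdeg1.
have compX := comp_idx idxP (d ord0 j1).
have /(vanishes_at_point Xh yE) : vanishes_at ('X_(idx (d ord0 j1)) : {mpoly K[n.+1]}) y.
  apply: h Xh _ => w iw; rewrite compX meval_autocor big1 // => a _; rewrite big1 // => b /eqP /dw /= e.
  by rewrite (iw b) ?mulr0 //; lia.
rewrite compX meval_autocor (bigD1 ord0) //= (bigD1 j1) //= big1 => [|b /andP[/eqP/dw /= e bj]]; last first.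
  by move: bj; rewrite -val_eqE /=; move/eqP; lia.
rewrite big1 => [|a a0]; last first.
  rewrite big1 // => b /eqP/dw /= e.
  have b1 : v b = 0.
    have a0' : (0 < a)%N by rewrite lt0n -[0%N]/(val (ord0 : 'I_k.+1)) val_eqE.
    rewrite /v -!val_eqE /=.
    by rewrite !gtn_eqF ?addr0 //; lia.
  by rewrite b1 mulr0.
rewrite v0 /v eqxx eq_sym j10 !addr0 add0r mulr1 => /eqP.
by rewrite oner_eq0.
Qed.

(** The strata form a chain of length [k]; no chain is longer, by [chain_length_le]. *)
Theorem autocor_variety_dim : has_dim X k.
Proof.
split.
  exists stratum; split=> [i _|i ik]; last exact: stratum_lt.
  by split; [exact: stratum_closed|exact: stratum_irreducible].
move=> s Z; apply: (@chain_length_le K n k gam (autocor_tuple_homog K d lag) X).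
exact: vanishing_comp.
Qed.

End AutocorVariety.

(** * Indexing the box *)

Lemma radixD q k k' m : (radix q k m + radix q k' m = radix q (fun i => k i + k' i) m)%N.
Proof. by rewrite /radix -big_split; apply: eq_bigr => i _; rewrite mulnDl. Qed.

Lemma eq_radix q k k' m : (forall i, (i < m)%N -> k i = k' i) -> radix q k m = radix q k' m.
Proof. by move=> kk; apply: eq_big_nat => i /andP[_ im]; rewrite kk. Qed.

Lemma radix_modn q k m : (0 < m)%N -> (k 0 <= q 0)%N -> (radix q k m %% (q 0).+1 = k 0)%N.
Proof.
move=> m0 kq; rewrite /radix big_ltn // big_geq // muln1.
have /dvdnP[c ->] : ((q 0).+1 %| \sum_(1 <= i < m) k i * \prod_(0 <= j < i) (q j).+1)%N.
  rewrite big_nat_cond; apply: dvdn_sum => i /andP[/andP[i0 _] _].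
  by rewrite [(\prod_(_ <= _ < _) _)%N]big_ltn // dvdn_mull // dvdn_mulr.
by rewrite addnC modnMDl modn_small.
Qed.

Section Box.
Variables (d : nat) (q : 'I_d -> nat).

Definition nat_fun (f : 'I_d -> nat) (j : nat) := oapp f 0%N (insub j : option 'I_d).

Lemma nat_funE f (i : 'I_d) : nat_fun f i = f i.
Proof. by rewrite /nat_fun valK. Qed.

Definition box_weight (k : box q) := radix (nat_fun q) (nat_fun (fun i => k i : nat)) d.

Definition box_top := (\prod_(i < d) (q i + 1) - 1)%N.

Lemma prod_box_top : (\prod_(0 <= j < d) (nat_fun q j).+1 = box_top.+1)%N.
Proof.
rewrite big_mkord /box_top subn1 prednK; last by apply: prodn_gt0 => i; rewrite addn1.
by apply: eq_bigr => i _; rewrite nat_funE addn1.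
Qed.

Lemma nat_fun_le (k : box q) j : (j < d)%N -> (nat_fun (fun i => k i : nat) j <= nat_fun q j)%N.
Proof. by move=> ltjd; rewrite -[j]/(val (Ordinal ltjd)) !nat_funE -ltnS. Qed.

Lemma box_weight_lt k : (box_weight k < box_top.+1)%N.
Proof. by rewrite -prod_box_top; apply: radix_lt => j; apply: nat_fun_le. Qed.

Definition box_index (k : box q) : 'I_box_top.+1 := Ordinal (box_weight_lt k).

Lemma box_index_inj : injective box_index.
Proof.
move=> k k' /(congr1 val) /= e; apply/ffunP => i; apply: val_inj => /=.
have := radix_inj (@nat_fun_le k) (@nat_fun_le k') e (ltn_ord i).
by rewrite !nat_funE.
Qed.

Lemma box_index_bij : bijective box_index.
Proof.
apply: inj_card_bij; first exact: box_index_inj.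
rewrite card_ord card_dep_ffun -[foldr _ _ _]/(foldr muln 1%N _) foldrE big_map big_enum /=.
rewrite -prod_box_top big_mkord; apply: eq_leq; apply: eq_bigr => i _.
by rewrite nat_funE card_ord.
Qed.

Lemma box_index_inverse : exists g, cancel box_index g /\ cancel g box_index.
Proof. by have [g gK Kg] := box_index_bij; exists g. Qed.

Definition index_box := sval (cid box_index_inverse).

Lemma index_boxP : cancel box_index index_box /\ cancel index_box box_index.
Proof. exact: (svalP (cid box_index_inverse)). Qed.

Lemma index_boxK : cancel index_box box_index. Proof. exact: index_boxP.2. Qed.
Lemma box_indexK : cancel box_index index_box. Proof. exact: index_boxP.1. Qed.

Lemma box_weight_add (k l k' l' : box q) : (forall i, l i + k' i = l' i + k i)%N ->
  (box_weight l + box_weight k' = box_weight l' + box_weight k)%N.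
Proof.
move=> e; rewrite /box_weight !radixD; apply: eq_radix => j jd.
by rewrite -[j]/(val (Ordinal jd)) !nat_funE e.
Qed.

Lemma box_diff_subproof (k l : box q) i : (l i + q i - k i < (2 * q i).+1)%N.
Proof. by have := ltn_ord (l i); have := ltn_ord (k i); lia. Qed.

Definition box_diff (k l : box q) : lag q := [ffun i => Ordinal (box_diff_subproof k l i)].

Lemma box_diff_eq (k l : box q) (t : lag q) :
  [forall i, (l i)%:Z == (k i)%:Z + lagz t i] = (box_diff k l == t).
Proof.
apply/forallP/eqP => [h|<- i].
  apply/ffunP => i; rewrite ffunE; apply: val_inj => /=.
  have := h i; have := ltn_ord (k i); rewrite /lagz.
  by move: (nat_of_ord (l i)) (nat_of_ord (k i)) (nat_of_ord (t i)) => a b c; lia.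
rewrite /lagz ffunE /=; have := ltn_ord (k i).
by move: (nat_of_ord (l i)) (nat_of_ord (k i)) => a b; lia.
Qed.

Definition index_diff (i j : 'I_box_top.+1) : lag q := box_diff (index_box i) (index_box j).

Lemma index_diff_coord i j i' j' : index_diff i j = index_diff i' j' ->
  forall x, (index_box j x + index_box i' x = index_box j' x + index_box i x)%N.
Proof.
move=> e x; have := congr1 (fun t : lag q => nat_of_ord (t x)) e.
rewrite !ffunE /=; have := ltn_ord (index_box i x); have := ltn_ord (index_box i' x).
move: (nat_of_ord (index_box i x)) (nat_of_ord (index_box j x)) => a b.
by move: (nat_of_ord (index_box i' x)) (nat_of_ord (index_box j' x)) => a' b'; lia.
Qed.

Lemma index_weight i : box_weight (index_box i) = i.
Proof. by have := congr1 val (index_boxK i). Qed.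

Lemma index_diff_add i j i' j' : index_diff i j = index_diff i' j' -> (j + i' = j' + i)%N.
Proof.
by move=> /index_diff_coord /box_weight_add; rewrite !index_weight.
Qed.

Definition opp_lag (t : lag q) : lag q := [ffun i => rev_ord (t i)].

Lemma index_diff_opp i j : index_diff j i = opp_lag (index_diff i j).
Proof.
apply/ffunP => x; rewrite !ffunE; apply: val_inj => /=.
have := ltn_ord (index_box i x); have := ltn_ord (index_box j x).
by move: (nat_of_ord (index_box i x)) (nat_of_ord (index_box j x)) => a b; lia.
Qed.

Lemma opp_lagK : involutive opp_lag.
Proof. by move=> t; apply/ffunP => i; rewrite !ffunE rev_ordK. Qed.

Definition rev_box (k : box q) : box q := [ffun i => rev_ord (k i)].

(** Reversing the box is complementing mixed radix digits, so the weights of [k] and of its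
    reversal add up to the largest weight. *)
Lemma index_box_rev i : index_box (rev_ord i) = rev_box (index_box i).
Proof.
apply: (can_inj box_indexK); rewrite index_boxK; apply: val_inj => /=.
pose z : box q := [ffun=> ord0]; pose m : box q := [ffun=> ord_max].
have W0 : box_weight z = 0%N.
  rewrite /box_weight /radix big1_seq // => j; rewrite mem_index_iota => /andP[_ /andP[_ jd]].
  by rewrite -[j]/(val (Ordinal jd)) nat_funE ffunE mul0n.
have sum k : (box_weight (rev_box k) + box_weight k = box_weight m)%N.
  rewrite -[RHS]addn0 -W0; apply: box_weight_add => x; rewrite !ffunE /=.
  by have := ltn_ord (k x); move: (nat_of_ord (k x)) => a; lia.
(* [m] has the largest weight since its weight is at least that of the last index *)
have mE : box_weight m = box_top.
  apply/eqP; rewrite eqn_leq -ltnS box_weight_lt /=.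
  by rewrite -(sum (index_box ord_max)) index_weight leq_addl.
by have := sum (index_box i); rewrite index_weight mE subSS => /(canRL (addnK _)) ->.
Qed.

Lemma index_diff_rev i j : index_diff (rev_ord i) (rev_ord j) = index_diff j i.
Proof.
rewrite /index_diff !index_box_rev; apply/ffunP => x.
rewrite [LHS]ffunE [RHS]ffunE; apply: val_inj => /=; rewrite !ffunE /=.
have := ltn_ord (index_box i x); have := ltn_ord (index_box j x).
by move: (nat_of_ord (index_box i x)) (nat_of_ord (index_box j x)) => a b; lia.
Qed.

Section Autocovariance.
Variable K : numFieldType.
Notation Gam := (autocor K index_diff).

Lemma autocor_opp t : Gam (opp_lag t) = Gam t.
Proof.
rewrite /autocor (exchange_big_dep xpredT) //=; apply: eq_bigr => j _.
apply: eq_big => [i|i _]; last exact: mulrC.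
by rewrite index_diff_opp (inv_eq opp_lagK) opp_lagK.
Qed.

Lemma autocor_rev t : permute_vars (@rev_ord box_top.+1) (Gam t) = Gam t.
Proof.
rewrite -[in RHS]autocor_opp /autocor raddf_sum /= (reindex_inj rev_ord_inj).
apply: eq_bigr => i _; rewrite raddf_sum /= (reindex_inj rev_ord_inj).
apply: eq_big => [j|j _]; last by rewrite permute_varsM !permute_varsX !rev_ordK.
by rewrite index_diff_rev index_diff_opp (inv_eq opp_lagK).
Qed.

(** The sign of the first nonzero entry decides. *)
Lemma lex_ge0_or_opp (s : seq int) :
  (([seq 0 | _ <- s] : seqlexi int) <= s)%O \/
  (([seq 0 | _ <- s] : seqlexi int) <= [seq - x | x <- s])%O.
Proof.
elim: s => [|x s IH] /=; first by left.
rewrite !lexi_cons oppr_ge0 oppr_le0.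
by have [x0|x0|x0] := ltgtP x 0 => /=; [right|left|].
Qed.

Lemma nonneg_lag_or_opp t : t \in nonneg_lags q \/ opp_lag t \in nonneg_lags q.
Proof.
rewrite !inE.
have z : tval [tuple (0 : int) | i < d] = [seq 0 | _ <- [seq lagz t i | i <- enum 'I_d]].
  by rewrite /= -map_comp; apply: eq_map.
have o : tval (lag_lexi (opp_lag t)) = [seq - x | x <- [seq lagz t i | i <- enum 'I_d]].
  rewrite /= -map_comp; apply: eq_map => i /=; rewrite /lagz ffunE /=.
  by have := ltn_ord (t i); move: (nat_of_ord (t i)) => a; lia.
have := lex_ge0_or_opp [seq lagz t i | i <- enum 'I_d]; rewrite -z -o; exact.
Qed.

Lemma nth_lag_surj t : t \in nonneg_lags q -> exists j, nth_lag j = t.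
Proof.
move=> tn; exists (cast_ord (card_nonneg_lags q) (enum_rank_in tn t)).
by rewrite /nth_lag cast_ordK enum_rankK_in.
Qed.

Lemma autocor_nonneg t : exists j : 'I_(ambient_dim q).+1, Gam (nth_lag j) = Gam t.
Proof.
have [/nth_lag_surj[j <-]|/nth_lag_surj[j jE]] := nonneg_lag_or_opp t; first by exists j.
by exists j; rewrite jE autocor_opp.
Qed.

Definition box_fun (v : 'I_box_top.+1 -> K) : {ffun box q -> K} := [ffun k => v (box_index k)].

Lemma autocov_autocor (a : {ffun box q -> K}) t :
  autocov a t = (Gam t).@[fun i => a (index_box i)].
Proof.
rewrite meval_autocor /autocov (reindex index_box); last first.
  by apply: onW_bij; exists box_index; [exact: index_boxK|exact: box_indexK].
apply: eq_bigr => i _; rewrite (reindex index_box); last first.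
  by apply: onW_bij; exists box_index; [exact: index_boxK|exact: box_indexK].
by apply: eq_bigl => j; rewrite box_diff_eq.
Qed.

Lemma autocov_varietyP y : autocov_variety (q := q) y <->
  exists v, (exists i, v i != 0) /\ line y = <[autocor_vec (K := K) index_diff (@nth_lag d q) v]>%VS.
Proof.
have vecE (a : {ffun box q -> K}) :
    autocov_vec a = autocor_vec index_diff (@nth_lag d q) (fun i => a (index_box i)).
  by apply/rowP => j; rewrite !mxE autocov_autocor.
split=> [[a a0 yE]|[v [[i vi] yE]]].
  exists (fun i => a (index_box i)); rewrite yE vecE; split=> //.
  apply: contrapT => h; move/eqP: a0; apply; apply/ffunP => k; rewrite ffunE.
  apply: contrapT => /eqP ak; apply: h; exists (box_index k).
  by rewrite box_indexK.
exists (box_fun v).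
  by apply: contraNneq vi => /ffunP/(_ (index_box i)); rewrite !ffunE index_boxK => ->.
rewrite yE vecE; congr <[_]>%VS; apply/rowP => j; rewrite !mxE.
by apply: meval_eq => l; rewrite ffunE index_boxK.
Qed.
End Autocovariance.

Section FirstCoordinate.
Hypothesis hd : (0 < d)%N.
Let i0 : 'I_d := Ordinal hd.

Lemma box_weight_mod (k : box q) : (box_weight k %% (q i0).+1 = k i0)%N.
Proof.
have := radix_modn (q := nat_fun q) (k := nat_fun (fun i => k i : nat)) hd (nat_fun_le k hd).
by rewrite -[0%N]/(val i0) !nat_funE.
Qed.

Lemma index_diff_mod i j i' j' : index_diff i j = index_diff i' j' ->
  (xdeg (q i0) j + xdeg (q i0) i' = xdeg (q i0) j' + xdeg (q i0) i)%N.
Proof.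
move=> /index_diff_coord /(_ i0).
by rewrite -!box_weight_mod !index_weight.
Qed.

Lemma index_diff_div i j i' j' : index_diff i j = index_diff i' j' ->
  (ydeg (q i0) j + ydeg (q i0) i' = ydeg (q i0) j' + ydeg (q i0) i)%N.
Proof.
move=> e; have := index_diff_mod e; have := index_diff_add e.
rewrite (indexE (q i0) i) (indexE (q i0) j) (indexE (q i0) i') (indexE (q i0) j').
move: (xdeg _ _) (xdeg _ _) (xdeg _ _) (xdeg _ _) (ydeg _ _) (ydeg _ _) (ydeg _ _) (ydeg _ _).
by move=> x1 x2 x3 x4 y1 y2 y3 y4; nia.
Qed.

End FirstCoordinate.

Lemma autocov_variety_has_dim (K : numFieldType) : has_dim (@autocov_variety K d q) box_top.
Proof.
have [idx idxP] := boolp.choice (autocor_nonneg K).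
exact: (autocor_variety_dim index_diff_add idxP (@autocov_varietyP K)).
Qed.

End Box.

(** * Dimension and degree *)

(** The mixed radix index of a point of the box splits into its first coordinate, which serves
    as the exponent of [x], and the weight of the others, the exponent of [y]; having [d > 1]
    makes the latter nontrivial, as [special_fibre] requires. *)
Lemma autocov_variety_has_degree (K : numClosedFieldType) (d : nat) (q : 'I_d -> nat) :
  (1 < d)%N -> (forall i, (0 < q i)%N) -> has_degree (@autocov_variety K d q) (2 ^ (box_top q - 1))%N.
Proof.
move=> d1 q0; have hd : (0 < d)%N by apply: ltnW.
have [idx idxP] := boolp.choice (@autocor_nonneg d q K).
pose p := q (Ordinal hd); pose n := (\prod_(i < d | i != Ordinal hd) (q i + 1) - 1)%N.
have prod_gt1 : (1 < \prod_(i < d | i != Ordinal hd) (q i + 1))%N.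
  rewrite (bigD1 (Ordinal d1)) //=.
  have : (0 < \prod_(i < d | (i != Ordinal hd) && (i != Ordinal d1)) (q i + 1))%N.
    by apply: prodn_gt0 => i; rewrite addn1.
  have := q0 (Ordinal d1); move: (q _) (\prod_(_ < _ | _) _)%N => a b; nia.
have n0 : (0 < n)%N by rewrite subn_gt0.
have kE : (box_top q).+1 = (p.+1 * n.+1)%N.
  rewrite /box_top subn1 prednK; last by apply: prodn_gt0 => i; rewrite addn1.
  by rewrite (bigD1 (Ordinal hd)) //= addn1 /n subn1 prednK // ltnW.
have two0 : (2%:R : K) != 0 by rewrite pnatr_eq0.
have [D DP] := finite_over_autocor (K := K) (@ord_inj _) (@index_diff_add d q) idxP.
pose P := @special_point K p n (box_top q).
have fibre Q : (forall t, (autocor K (@index_diff d q) t).@[Q] = (autocor K (@index_diff d q) t).@[P]) ->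
    exists e : bool, Q =1 (fun i => (-1) ^+ e * P i) \/ Q =1 (fun i => (-1) ^+ e * P (rev_ord i)).
  move=> QP; apply: (special_fibre (q0 _) n0 kE (index_diff_mod hd) (index_diff_div hd)) => t.
  by rewrite -!meval_autocor.
have [g g0 gP] := autocor_conductor idxP DP (fun Q h b => special_unramified (q0 _) n0 kE
   (index_diff_mod hd) (index_diff_div hd) two0 (fibre Q h)) two0 (@rev_ordK _) (@autocor_rev d q K) fibre.
apply: (@degree_quadric_involution K (box_top q) (@rev_ord _) (@rev_ordK _) two0 ord0 _ (ambient_dim q)
   (autocor_tuple K (@index_diff d q) (@nth_lag d q)) _ _ _ _ g g0).
- rewrite -val_eqE /= subn1 -lt0n -ltnS kE; have := q0 (Ordinal hd); rewrite -/p; nia.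
- exact: autocor_tuple_homog.
- by move=> j; rewrite tnth_mktuple; exact: autocor_rev.
- move=> f e fh; apply: (vanishing_comp (@index_diff_add d q) idxP _ fh) => y; exact: autocov_varietyP.
- move=> m f fh fs; apply: gP; split=> //.
  by rewrite (negate_homog fh) exprM sqrrN expr1n expr1n scale1r.
Qed.

Theorem theorem3p9 (R : realType) (d : nat) (q : 'I_d -> nat)
    (hd : (1 <= d)%N) (hq : forall i : 'I_d, (0 < q i)%N) :
  let Q := (\prod_(i < d) (q i + 1) - 1)%N in
  has_dim (@autocov_variety R[i] d q) Q /\
  ((1 < d)%N ->
     has_degree (@autocov_variety R[i] d q) (2 ^ (Q - 1))%N /\
     (2 ^ (Q - 1) = 2 ^ (\prod_(i < d) (q i + 1) - 2))%N).
Proof.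
move=> Q; split; first exact: (autocov_variety_has_dim q R[i]).
move=> d1; split; last by rewrite /Q -subnDA.
exact: (autocov_variety_has_degree R[i] d1 hq).
Qed.
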